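(* Let $C$ be a random vector in $\mathbb{R}_+^n$ satisfying the asymptotic homogeneity assumption (stated in the context) with exponent $\alpha$ and function $h$. Let $\ell_1,\ell_2,\dots$ be independent copies of the random affine function $\ell(p)=\langle C,p\rangle$, $p\in\overline{\Delta}_n$. Then, as $K\to\infty$, the distribution $\nu_K$ of the random function $$\Psi_K:=K^{\frac1{n+\alpha}}\min\{\ell_1,\dots,\ell_K\}$$ converges weakly, as a probability measure on $\mathcal{C}$, to a probability measure $\mu$ supported on $\mathcal{C}_+\subset\mathcal{C}$ (i.e. $\mu(\mathcal{C}_+)=1$).
   Context: Let $n\ge2$, $\mathbb{R}_+^n:=(0,\infty)^n$, $\Delta_n:=\{p\in(0,1)^n:p_1+\cdots+p_n=1\}$, $\overline{\Delta}_n$ its closure, $\langle p,x\rangle=\sum_ip_ix_i$. $\mathcal{C}:=\{\psi:\overline{\Delta}_n\to[0,\infty)\text{ continuous and concave}\}$, $\mathcal{C}_+:=\{\psi\in\mathcal{C}:\psi>0\text{ on }\Delta_n\}$. $\mathcal{C}$ carries the (metrizable) topology of uniform convergence on compact subsets of $\Delta_n$ and its Borel $\sigma$-algebra. Asymptotic homogeneity assumption: $C=(C_1,\dots,C_n)$ has a joint density $\rho$ on $\mathbb{R}_+^n$, and there exist $\alpha\in\mathbb{R}$ and a non-negative measurable function $h$ on $\mathbb{R}_+^n$ with $\int_{\mathbb{R}_+^n}h(x)\,dx\in(0,\infty]$ such that $\lim_{\kappa\to0^+}\kappa^{-\alpha}\rho(\kappa x)=h(x)$ for $x\in\mathbb{R}_+^n$,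 uniformly for $x\in\Delta_n$. (Under this assumption $\alpha$ is uniquely determined, $\alpha>-n$, $h$ is homogeneous of order $\alpha$, and $h$ is integrable on bounded Borel subsets of $\mathbb{R}_+^n$.) *)

(* Defs.v *)
From HB Require Import structures.
From mathcomp Require Import all_boot all_order all_algebra.
From mathcomp Require Import finmap ring lra.
From mathcomp Require Import all_classical all_reals all_analysis measurable_realfun.

Set Implicit Arguments.
Unset Strict Implicit.
Unset Printing Implicit Defensive.

Import Order.TTheory GRing.Theory Num.Theory.
Import numFieldNormedType.Exports.

Local Open Scope classical_set_scope.
Local Open Scope ring_scope.

Notation borel X := (g_sigma_algebraType (@open X)).

Section spaces.
Variables (R : realType) (n : nat).

Definition orthant_set : set 'rV[R]_n := [set x | forall i, 0 < x 0 i].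

Definition open_simplex : set 'rV[R]_n :=
  [set p | (forall i, 0 < p 0 i < 1) /\ \sum_(i < n) p 0 i = 1].

Definition orthant : Type := set_type orthant_set.
HB.instance Definition _ := Topological.on orthant.
Coercion orthant_val (c : orthant) : 'rV[R]_n := set_val c.

Lemma const1_orthant : (const_mx 1 : 'rV[R]_n) \in orthant_set.
Proof. by rewrite inE => i; rewrite mxE. Qed.

HB.instance Definition _ :=
  isPointed.Build orthant (exist _ (const_mx 1) const1_orthant).

Definition simplex : Type := set_type (closure open_simplex).
HB.instance Definition _ := Topological.on simplex.
Coercion simplex_val (p : simplex) : 'rV[R]_n := set_val p.

Definition concave (psi : simplex -> R) : Prop :=
  forall (p q r : simplex) (t : R), 0 <= t <= 1 ->
    r = t *: (p : 'rV[R]_n) + (1 - t) *: (q : 'rV[R]_n) :> 'rV[R]_n ->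
    t * psi p + (1 - t) * psi q <= psi r.

(* The compact subsets of the open simplex.  Elements of the function space are
   continuous up to the boundary, but uniform convergence is only asked for on
   these sets. *)
Definition inner_compact : set (set simplex) :=
  [set A | compact A /\ A `<=` [set p : simplex | open_simplex p]].

Definition concave_set : set {family inner_compact, simplex -> R} :=
  [set psi | [/\ continuous (psi : simplex -> R),
                 (forall p, 0 <= psi p) & concave psi]].

Definition concave_fun : Type := set_type concave_set.
HB.instance Definition _ := Uniform.on concave_fun.
Definition concave_fun_val (psi : concave_fun) : simplex -> R := set_val psi.
Coercion concave_fun_val : concave_fun >-> Funclass.

Lemma zero_concave :
  ((fun=> 0) : {family inner_compact, simplex -> R}) \in concave_set.
Proof.
rewrite inE; split=> [p|//|p q r t _ _]; first by exact: (@cst_continuous simplex R).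
by rewrite !mulr0 addr0.
Qed.

HB.instance Definition _ :=
  isPointed.Build concave_fun (exist _ (fun=> 0) zero_concave).

Definition concave_pos : set concave_fun :=
  [set psi : concave_fun | forall p : simplex, open_simplex p -> 0 < psi p].

End spaces.

Section measurability.
Context {d} {T : measurableType d} {R : realType}.

(* An event that is stable under small perturbations of finitely many real
   random variables is measurable. *)
Lemma locally_determined_measurable (I : finType) (X : T -> I -> R)
    (S : set T) :
  (forall i, measurable_fun setT (X ^~ i)) ->
  (forall w, S w -> exists2 e : R, 0 < e &
     forall w', (forall i, `|X w i - X w' i| < e) -> S w') ->
  measurable S.
Proof.
move=> mX locS.
pose box (qr : {ffun I -> rat} * rat) : set T :=
  \bigcap_(i in [set: I]) [set w | `|X w i - ratr (qr.1 i)| < ratr qr.2].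
pose good qr := if pselect (box qr `<=` S) then box qr else set0.
have mbox qr : measurable (box qr).
  apply: fin_bigcap_measurable => // i _.
  have mf : measurable_fun setT (fun w => `|X w i - ratr (qr.1 i)|).
    apply: (measurableT_comp (@normr_measurable R setT)).
    exact: measurable_funB.
  rewrite -[X in measurable X]setTI.
  rewrite (_ : [set w | _] =
    (fun w => `|X w i - ratr (qr.1 i)|) @^-1` `]-oo, ratr qr.2[); last first.
    by apply/seteqP; split=> w /=; rewrite in_itv.
  exact: mf.
rewrite (_ : S = \bigcup_qr good qr); last first.
  apply/seteqP; split=> [w Sw|w [qr _]]; last first.
    by rewrite /good; case: pselect => [sub /sub|].
  have [e e0 eS] := locS _ Sw.
  have [r /[!in_itv]/= /andP[r0 re]] : exists r : rat, ratr r \in `]0, e / 2[.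
    by apply: rat_in_itvoo; rewrite divr_gt0.
  have /choice[q qP] (i : I) :
      exists q : rat, ratr q \in `]X w i - ratr r, X w i + ratr r[.
    by apply: rat_in_itvoo; rewrite ltrBlDr -addrA ltrDl addr_gt0.
  have wq i : `|X w i - ratr (q i)| < ratr r.
    have := qP i; rewrite in_itv/= => /andP[h1 h2].
    by rewrite ltr_norml; apply/andP; split; lra.
  exists ([ffun i => q i], r) => //; rewrite /good; case: pselect => [sub|nsub].
    by move=> i _ /=; rewrite ffunE.
  apply: nsub => w' bw'; apply: eS => i.
  have := bw' i Logic.I; rewrite /= ffunE; have := wq i.
  by rewrite !ltr_norml => /andP[? ?] /andP[? ?]; apply/andP; split; lra.
apply: countable_bigcupT_measurable; first exact: countableP.
move=> qr; rewrite /good; case: pselect => sub; first exact: mbox.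
exact: measurable0.
Qed.

Lemma continuous_borel_measurable (X : ptopologicalType) (f : X -> R) :
  continuous f -> measurable_fun setT (f : borel X -> R).
Proof.
move=> cf; apply: (measurability _ (RGenOInfty.measurableE R)).
move=> _ [_ [x ->] <-]; rewrite setTI; apply: sub_sigma_algebra.
by apply: open_comp; [move=> y _; exact: cf|exact: interval_open].
Qed.

Lemma measurable_coord n i :
  measurable_fun setT (fun x : borel 'rV[R]_n => x 0 i).
Proof.
by apply: (@continuous_borel_measurable _ (fun x : 'rV[R]_n => x 0 i)) => x;
  exact: coord_continuous.
Qed.

Lemma continuous_orthant_coord n i :
  continuous (fun c : orthant R n => orthant_val c 0 i).
Proof.
move=> c; apply: (@continuous_comp _ _ _ (@orthant_val R n)
  (fun x : 'rV[R]_n => x 0 i)); last exact: coord_continuous.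
exact: (@initial_continuous _ _ (set_val : orthant_set (R := R) (n := n) -> _)).
Qed.

Lemma measurable_orthant_coord n i :
  measurable_fun setT (fun c : borel (orthant R n) => orthant_val c 0 i).
Proof. by apply: continuous_borel_measurable; exact: continuous_orthant_coord. Qed.

Lemma measurable_rV n (X : T -> borel 'rV[R]_n) :
  (forall i, measurable_fun setT (fun w => X w 0 i)) -> measurable_fun setT X.
Proof.
move=> mX; have := @measurability _ _ T (borel 'rV[R]_n) setT X (@open 'rV[R]_n) erefl. apply.
move=> _ [U oU <-]; rewrite setTI.
apply: (@locally_determined_measurable _ (fun w i => X w 0 i)) => // w Uw.
have /nbhs_ballP[e e0 eU] : nbhs (X w : 'rV[R]_n) U by exact: open_nbhs_nbhs.
exists e => // w' ww'; apply: eU; split=> // i j.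
by rewrite (ord1 i) -ball_normE /=; exact: ww'.
Qed.

End measurability.

Section lebesgue.
Variable R : realType.

Definition row_cons n (xv : measurableTypeR R * borel 'rV[R]_n) :
    borel 'rV[R]_n.+1 :=
  row_mx (xv.1%:M : 'rV[R]_1) (xv.2 : 'rV[R]_n).

Lemma measurable_row_cons n : measurable_fun setT (@row_cons n).
Proof.
apply: measurable_rV => i; rewrite /row_cons.
case: (@splitP 1 n i) => j ij.
  have -> : (fun xv : measurableTypeR R * borel 'rV[R]_n =>
      row_mx (xv.1%:M : 'rV[R]_1) (xv.2 : 'rV[R]_n) 0 i) = fst.
    apply/funext => xv; have -> : i = lshift n j :> 'I_(1 + n) by apply: val_inj.
    by rewrite row_mxEl mxE (ord1 j) eqxx mulr1n.
  exact: measurable_fst.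
have -> : (fun xv : measurableTypeR R * borel 'rV[R]_n =>
      row_mx (xv.1%:M : 'rV[R]_1) (xv.2 : 'rV[R]_n) 0 i) =
    (fun v : borel 'rV[R]_n => v 0 j) \o snd.
  apply/funext => xv; have -> : i = rshift 1 j :> 'I_(1 + n) by apply: val_inj.
  by rewrite row_mxEr.
by apply: measurableT_comp => //; exact: measurable_coord.
Qed.

Lemma row_consK n : cancel (@row_cons n)
  (fun v => ((v : 'rV[R]_(1 + n)) 0 (lshift n ord0), rsubmx (v : 'rV[R]_(1 + n)))).
Proof.
move=> [x v] /=; rewrite /row_cons row_mxKr; congr pair.
by rewrite row_mxEl mxE mulr1n.
Qed.

Lemma measurable_row_uncons n : measurable_fun setT
  (fun v : borel 'rV[R]_n.+1 => ((v : 'rV[R]_(1 + n)) 0 (lshift n ord0) : measurableTypeR R,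
     rsubmx (v : 'rV[R]_(1 + n)) : borel 'rV[R]_n)).
Proof.
apply/measurable_fun_pairP; split; first exact: measurable_coord.
apply: measurable_rV => i /=.
rewrite (_ : (fun _ => _) = fun v : borel 'rV[R]_n.+1 => v 0 (rshift 1 i)).
  exact: measurable_coord.
by apply/funext => v; rewrite mxE.
Qed.

Section succ.
Variables (n : nat) (mu : {sigma_finite_measure set (borel 'rV[R]_n) -> \bar R}).

Definition lebesgue_succ : set (borel 'rV[R]_n.+1) -> \bar R :=
  pushforward (lebesgue_measure \x mu)%E (@row_cons n).

Let lebesgue_succ0 : lebesgue_succ set0 = 0%E.
Proof. by rewrite /lebesgue_succ /pushforward preimage_set0 measure0. Qed.

Let lebesgue_succ_ge0 A : (0 <= lebesgue_succ A)%E.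
Proof. exact: (measure_ge0 (lebesgue_measure \x mu)%E). Qed.

Let lebesgue_succ_sigma_additive : semi_sigma_additive lebesgue_succ.
Proof.
apply: (@measure_semi_sigma_additive _ _ _
  (pushforward (lebesgue_measure \x mu)%E (@row_cons n))).
exact: measurable_row_cons.
Qed.

HB.instance Definition _ := isMeasure.Build _ _ _ lebesgue_succ
  lebesgue_succ0 lebesgue_succ_ge0 lebesgue_succ_sigma_additive.

Let lebesgue_succ_sigma_finite : sigma_finite setT lebesgue_succ.
Proof.
pose g (v : borel 'rV[R]_n.+1) : measurableTypeR R * borel 'rV[R]_n :=
  ((v : 'rV[R]_(1 + n)) 0 (lshift n ord0), rsubmx (v : 'rV[R]_(1 + n))).
have gK : g \o @row_cons n = id by apply/funext => xv; exact: row_consK.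
have /sigma_finiteP[F [TF ndF Foo]] := sigma_finiteT (@lebesgue_measure R).
have /sigma_finiteP[G [TG ndG Goo]] := sigma_finiteT mu.
exists (fun k => g @^-1` (F k `*` G k)).
  rewrite -preimage_bigcup (_ : \bigcup_k _ = setT) ?preimage_setT//.
  apply/seteqP; split=> // -[x y] _.
  have [k _ Fkx] : (\bigcup_k F k) x by rewrite -TF.
  have [l _ Gly] : (\bigcup_k G k) y by rewrite -TG.
  exists (maxn k l) => //; split => /=.
  - by move: x Fkx; exact/subsetPset/ndF/leq_maxl.
  - by move: y Gly; exact/subsetPset/ndG/leq_maxr.
move=> k; have [mF Fk] := Foo k; have [mG Gk] := Goo k; split.
  by rewrite -[X in measurable X]setTI; apply: measurable_row_uncons => //;
    exact: measurableX.
rewrite /lebesgue_succ /pushforward -comp_preimage gK.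
rewrite [ltLHS](product_measure1E (@lebesgue_measure R) mu mF mG).
by rewrite lte_mul_pinfty// ge0_fin_numE.
Qed.

HB.instance Definition _ := Measure_isSigmaFinite.Build _ _ _ lebesgue_succ
  lebesgue_succ_sigma_finite.

End succ.

(* Lebesgue measure on R^n: R^0 is a point of mass 1, and on R^(m+1) it is the
   image of the product measure under (x, v) |-> row_cons (x, v). *)
Fixpoint lebesgue_rV n : {sigma_finite_measure set (borel 'rV[R]_n) -> \bar R} :=
  match n return {sigma_finite_measure set (borel 'rV[R]_n) -> \bar R} with
  | 0 => dirac (0 : borel 'rV[R]_0)
  | m.+1 => lebesgue_succ (lebesgue_rV m)
  end.

End lebesgue.

Section random_functions.
Context {d} {T : measurableType d} {R : realType} {n : nat}.

Definition ell (c : orthant R n) (p : simplex R n) : R :=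
  \sum_(i < n) (c : 'rV[R]_n) 0 i * (p : 'rV[R]_n) 0 i.

(* For K >= 1 this is a * min {ell (c 0), ..., ell (c (K - 1))}: the default
   value ell (c 0) of the iterated minimum is then already one of its terms.
   K = 0 is junk. *)
Definition scaled_min (a : R) (K : nat) (c : nat -> orthant R n)
    (p : simplex R n) : R :=
  a * \big[Num.min/ell (c 0%N) p]_(k < K) ell (c k) p.

Lemma simplex_coord_itv (p : simplex R n) i : 0 <= simplex_val p 0 i <= 1.
Proof.
have cl : closed [set y : 'rV[R]_n | y 0 i \in `[0, 1]].
  apply: (@preimage_closed _ _ (fun y : 'rV[R]_n => y 0 i) [set` `[0, 1]]).
    by move=> y _; exact: coord_continuous.
  exact: itv_closed.
suff : simplex_val p 0 i \in `[0, 1] by rewrite in_itv.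
apply/cl/(closureS _ (set_valP p)) => x [x01 _] /=.
by rewrite in_itv /=; have /andP[/ltW -> /ltW ->] := x01 i.
Qed.

Lemma orthant_coord_gt0 (c : orthant R n) i : 0 < orthant_val c 0 i.
Proof. exact: (set_valP c). Qed.

Lemma ell_ge0 c p : 0 <= ell c p.
Proof.
apply: sumr_ge0 => i _; rewrite mulr_ge0 ?(ltW (orthant_coord_gt0 _ _))//.
by have /andP[] := simplex_coord_itv p i.
Qed.

Lemma continuous_simplex_coord i :
  continuous (fun p : simplex R n => simplex_val p 0 i).
Proof.
move=> p; apply: (@continuous_comp _ _ _ (@simplex_val R n)
  (fun x : 'rV[R]_n => x 0 i)); last exact: coord_continuous.
exact: (@initial_continuous _ _ (set_val : closure (@open_simplex R n) -> _)).
Qed.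

Lemma ell_continuous c : continuous (ell c).
Proof.
apply: (@continuous_big _ _ _ _ _ add_continuous) => i _ p.
apply: (@continuous_comp _ _ _ (fun p : simplex R n => simplex_val p 0 i)
  ( *%R (orthant_val c 0 i))); last exact: mulrl_continuous.
exact: continuous_simplex_coord.
Qed.

Lemma ell_convex_comb c (p q r : simplex R n) (t : R) :
  r = t *: (p : 'rV[R]_n) + (1 - t) *: (q : 'rV[R]_n) :> 'rV[R]_n ->
  ell c r = t * ell c p + (1 - t) * ell c q.
Proof.
move=> rE; rewrite /ell !mulr_sumr -big_split; apply: eq_bigr => i _ /=.
by rewrite rE !mxE; ring.
Qed.

Lemma scaled_min_concave (a : R) (K : nat) (c : nat -> orthant R n) :
  0 <= a -> (scaled_min a K c : {family @inner_compact R n, simplex R n -> R})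
    \in @concave_set R n.
Proof.
move=> a0; rewrite inE; split.
- move=> p; apply: (@continuous_comp _ _ _
    (fun p => \big[Num.min/ell (c 0%N) p]_(k < K) ell (c k) p) ( *%R a));
    last exact: mulrl_continuous.
  move: p; elim: (index_enum _) => [|k s IH].
    rewrite (_ : (fun _ => _) = ell (c 0%N)); first exact: ell_continuous.
    by apply/funext => p; rewrite big_nil.
  rewrite (_ : (fun _ => _) = ell (c k) \min
    (fun p => \big[Num.min/ell (c 0%N) p]_(j <- s) ell (c j) p)).
    by apply: min_fun_continuous => //; exact: ell_continuous.
  by apply/funext => p; rewrite big_cons.
- move=> p; rewrite mulr_ge0//; elim: (index_enum _) => [|k s IH].
    by rewrite big_nil ell_ge0.
  by rewrite big_cons le_min ell_ge0.
- move=> p q r t /andP[t0 t1] rE; rewrite /scaled_min.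
  rewrite !(mulrCA _ a) -mulrDr ler_wpM2l//.
  elim: (index_enum _) => [|k s IH].
    by rewrite !big_nil (ell_convex_comb _ rE).
  rewrite !big_cons le_min; apply/andP; split.
    rewrite (ell_convex_comb _ rE) lerD// ler_wpM2l ?subr_ge0//.
      by rewrite ge_min lexx.
    by rewrite ge_min lexx.
  apply: le_trans IH; rewrite lerD// ler_wpM2l ?subr_ge0//.
    by rewrite ge_min lexx orbT.
  by rewrite ge_min lexx orbT.
Qed.

Lemma ell_dist (c c' : orthant R n) (e : R) p :
  (forall i, `|orthant_val c 0 i - orthant_val c' 0 i| < e) ->
  `|ell c p - ell c' p| <= n%:R * e.
Proof.
move=> ce; rewrite /ell -sumrB; apply: le_trans (ler_norm_sum _ _ _) _.
rewrite mulr_natl -[n in leRHS]card_ord -sumr_const; apply: ler_sum => i _.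
have /andP[p0 p1] := simplex_coord_itv p i.
rewrite -mulrBl normrM (ger0_norm p0) -[leRHS]mulr1.
by rewrite ler_pM// ltW.
Qed.

Lemma min_dist (x y x' y' e : R) : `|x - x'| <= e -> `|y - y'| <= e ->
  `|Num.min x y - Num.min x' y'| <= e.
Proof.
rewrite !ler_norml => /andP[? ?] /andP[? ?]; rewrite !minEle.
by case: ifPn => ?; case: ifPn => ?; apply/andP; split; lra.
Qed.

Lemma scaled_min_dist (a e : R) K (c c' : nat -> orthant R n) p : 0 <= a ->
  (forall k i, (k < K.+1)%N ->
     `|orthant_val (c k) 0 i - orthant_val (c' k) 0 i| < e) ->
  `|scaled_min a K c p - scaled_min a K c' p| <= a * (n%:R * e).
Proof.
move=> a0 cc'; rewrite /scaled_min -mulrBr normrM (ger0_norm a0) ler_wpM2l//.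
elim: (index_enum _) => [|k s IH].
  by rewrite !big_nil; apply: ell_dist => i; exact: cc'.
rewrite !big_cons; apply: min_dist => //.
by apply: ell_dist => i; apply: cc'; rewrite ltnS ltnW.
Qed.

Lemma concave_fun_nbhs (psi : concave_fun R n) (U : set (concave_fun R n)) :
  nbhs psi U -> exists2 e : R, 0 < e &
    forall phi : concave_fun R n, (forall p, `|psi p - phi p| < e) -> U phi.
Proof.
case=> _ /= [[W oW <-] Wpsi sU].
pose F := nbhs (set_val psi : {uniform` [set: simplex R n] -> R}).
have FW : F W.
  have : {family @inner_compact R n, F --> set_val psi}.
    apply/fam_cvgP => A _.
    by apply: (@uniform_subset_cvg _ _ _ setT).
  by apply; exact: open_nbhs_nbhs.
have /uniform_nbhs[E [+ EW]] := FW.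
rewrite -entourage_ballE => -[e e0 eE].
exists e => // phi phie; apply: sU; apply: EW => p _; apply: eE => /=.
by rewrite -ball_normE; exact: phie.
Qed.

Definition Psi (alpha : R) (C : nat -> {mfun T >-> borel (orthant R n)})
    (K : nat) (w : T) : borel (concave_fun R n) :=
  exist _ (scaled_min (K%:R `^ (n%:R + alpha)^-1) K (fun k => C k w))
    (scaled_min_concave K _ (powR_ge0 _ _)).

Lemma measurable_Psi alpha C K : measurable_fun setT (Psi alpha C K).
Proof.
have := @measurability _ _ T (borel (concave_fun R n)) setT (Psi alpha C K)
  (@open (concave_fun R n)) erefl.
apply; move=> _ [U oU <-]; rewrite setTI.
apply: (@locally_determined_measurable _ _ _ ('I_K.+1 * 'I_n)%type
  (fun w ki => orthant_val (C ki.1 w) 0 ki.2)).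
  move=> [k i] /=.
  exact: (measurableT_comp (measurable_orthant_coord (R := R) i)
    (measurable_funPT (C k))).
move=> w Uw.
have /concave_fun_nbhs[e e0 eU] : nbhs (Psi alpha C K w : concave_fun R n) U.
  exact: open_nbhs_nbhs.
set a : R := K%:R `^ (n%:R + alpha)^-1.
have an0 : 0 <= a * n%:R by rewrite mulr_ge0// powR_ge0.
have an1 : 0 < a * n%:R + 1 by rewrite ltr_wpDl.
exists (e / (a * n%:R + 1)); first exact: divr_gt0.
move=> w' ww'; apply: eU => p.
apply: le_lt_trans (_ : a * (n%:R * (e / (a * n%:R + 1))) < e).
  apply: scaled_min_dist; first exact: powR_ge0.
  by move=> k i kK; exact: (ww' (Ordinal kK, i)).
rewrite mulrA mulrCA gtr_pMr// ltr_pdivrMr// mul1r; lra.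
Qed.

HB.instance Definition _ alpha C K :=
  isMeasurableFun.Build _ _ _ _ (Psi alpha C K) (measurable_Psi alpha C K).

End random_functions.

Section hypotheses.
Context {R : realType} {n : nat}.
Local Notation Rplus := (@orthant_set R n : set (borel 'rV[R]_n)).

(* rho and h are functions on the orthant R_+^n; their values elsewhere are
   irrelevant. *)
Definition joint_density d (T : measurableType d) (P : probability T R)
    (C : {RV P >-> borel (orthant R n)}) (rho : borel 'rV[R]_n -> R) : Prop :=
  [/\ measurable_fun Rplus rho,
      (forall x, orthant_set x -> 0 <= rho x) &
      forall A : set (borel 'rV[R]_n), measurable A ->
        P [set w | A (orthant_val (C w))] =
          (\int[lebesgue_rV R n]_(x in A `&` Rplus) (rho x)%:E)%E].

Definition asymptotically_homogeneous (rho : borel 'rV[R]_n -> R) (alpha : R)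
    (h : borel 'rV[R]_n -> R) : Prop :=
  [/\ measurable_fun Rplus h,
      (forall x, orthant_set x -> 0 <= h x),
      (0 < \int[lebesgue_rV R n]_(x in Rplus) (h x)%:E)%E,
      (forall x, orthant_set x ->
         k `^ (- alpha) * rho (k *: (x : 'rV[R]_n)) @[k --> 0^'+] --> h x) &
      {uniform @open_simplex R n,
        (fun (k : R) (x : 'rV[R]_n) => k `^ (- alpha) * rho (k *: x)) @ 0^'+
          --> (h : 'rV[R]_n -> R)}].

End hypotheses.

Section probability.
Context {R : realType} {d d'} {T : measurableType d} {T' : measurableType d'}.
Variable P : probability T R.

Definition mutually_independent (I : choiceType) (X : I -> {RV P >-> T'}) : Prop :=
  forall (J : {fset I}) (A : I -> set T'), (forall i, measurable (A i)) ->
    P (\bigcap_(i in [set` J]) X i @^-1` A i) =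
      (\prod_(i <- J) P (X i @^-1` A i))%E.

Definition independent_copies d0 (T0 : measurableType d0)
    (P0 : probability T0 R) (X : nat -> {RV P >-> T'}) (X0 : {RV P0 >-> T'}) : Prop :=
  mutually_independent X /\
  forall k A, measurable A -> distribution P (X k) A = distribution P0 X0 A.

End probability.

(* Bounded continuous functions are Borel, so these integrals are the usual
   ones. *)
Definition converges_weakly {R : realType} (S : ptopologicalType)
    (nu : nat -> probability (borel S) R) (mu : probability (borel S) R) : Prop :=
  forall f : S -> R, continuous f -> (exists M, forall x, `|f x| <= M) ->
    (\int[nu K]_x (f x)%:E)%E @[K --> \oo] --> (\int[mu]_x (f x)%:E)%E.

(* Main.v *)
From HB Require Import structures.
Require Import Defs.
From mathcomp Require Import finmap.
From mathcomp Require Import all_boot all_order all_algebra ring lra.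
From mathcomp Require Import all_classical all_reals all_analysis.
From mathcomp Require Import measurable_realfun.

Set Implicit Arguments.
Unset Strict Implicit.
Unset Printing Implicit Defensive.

Import Order.TTheory GRing.Theory Num.Theory.
Import numFieldNormedType.Exports.

Local Open Scope classical_set_scope.
Local Open Scope ring_scope.

(** Rescale the sample points by K ^ (1 / (n + alpha)).  Near the origin rho is
nearly h, which is homogeneous, so K times the probability that a rescaled point
falls in a bounded set U converges to the integral of h over U
([tail_limit]).  That a concave function min_k ell_k exceeds given levels t_i at
given interior points p_i means that no rescaled coefficient vector lies in the
bounded set U of those x with <x, p_i> <= t_i for some i.  By independence this
has probability (1 - q) ^ K with K q converging to the integral of h over U, so
all these probabilities converge, to exp (- integral of h over U): in the limit
the points form a Poisson process of intensity h ([prob_passes],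
[cvg_exp_pow]).

It remains to build a law on the function space with these probabilities and to
upgrade their convergence to weak convergence.  The basic fact is
[concave_scale]: if p >= (1 - e) q coordinatewise then psi p >= (1 - e) psi q.  It
makes nonnegative concave functions with a common bound at the barycenter
equicontinuous inside the simplex, so that the topology is that of pointwise
convergence at countably many grid points ([concave_fun_grid_nbhs]), and a
function is known from the answers to countably many tests psi (p_i) > t_i.  A
consistent infinite list of answers, with one finite upper bound at the
barycenter, determines a unique concave function, continuous up to the boundary
([tests_limit_exists]).

The limits of the probabilities of finite lists of answers are realized by random
bits on [0, 1) obtained by cutting intervals ([prob_bits]); the limit law is the
law of the function that these bits determine.  If that function lies in an open
set U, then finitely many of its answers already force membership in U.  Hence
the probability of U under the limit law is at most the lower limit of its
probabilities under the given laws, which is weak convergence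
([converges_weakly_open], [limit_law_exists]).  The hypotheses of
[limit_law_exists] at the barycenter, a bound and positivity with probability
near 1, hold because the integral of h over a simplex of size r is a multiple of
r ^ (n + alpha), and n + alpha > 0 ([exponent_gt0]). *)

(** * Concave functions on the simplex *)

Lemma near_forall (T : topologicalType) (I : finType) (x : T)
    (Q : I -> T -> Prop) :
  (forall i, \forall y \near x, Q i y) -> \forall y \near x, forall i, Q i y.
Proof. exact: (@filter_forall _ _ Q (nbhs x) (nbhs_filter x)). Qed.

Lemma near_always (T : topologicalType) (x : T) (Q : T -> Prop) :
  (forall y, Q y) -> \forall y \near x, Q y.
Proof. exact: nearW. Qed.

Lemma near_mono (T : topologicalType) (x : T) (P Q : T -> Prop) :
  (forall y, P y -> Q y) -> nbhs x P -> nbhs x Q.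
Proof. by move=> PQ; exact: filterS. Qed.

Lemma near_mono2 (T : topologicalType) (x : T) (P Q S : T -> Prop) :
  (forall y, P y -> Q y -> S y) -> nbhs x P -> nbhs x Q -> nbhs x S.
Proof. by move=> PQS nP nQ; apply: filterS2 PQS nP nQ. Qed.

Lemma continuous_dist (R : realType) (T : topologicalType) (f : T -> R) :
  (forall x e, 0 < e -> \forall y \near x, `|f x - f y| < e) -> continuous f.
Proof. by move=> cf x; apply/cvgrPdist_lt => e; exact: cf. Qed.

Lemma continuous_near_ge (R : realType) (T : topologicalType) (f : T -> R) x z :
  {for x, continuous f} -> z < f x -> \forall y \near x, z <= f y.
Proof.
by move=> cf zx; apply: (filterS _ (cvgr_gt _ cf _ zx)) => y; exact: ltW.
Qed.

Lemma continuous_near_le (R : realType) (T : topologicalType) (f : T -> R) x z :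
  {for x, continuous f} -> f x < z -> \forall y \near x, f y <= z.
Proof.
by move=> cf zx; apply: (filterS _ (cvgr_lt _ cf _ zx)) => y; exact: ltW.
Qed.

Section simplex_points.
Context {R : realType} {n : nat}.
Implicit Types p q : simplex R n.

Lemma simplex_coord_ge0 p i : 0 <= simplex_val p 0 i.
Proof. by have /andP[] := simplex_coord_itv p i. Qed.

Lemma continuous_coord_sum (I : topologicalType) (f : 'I_n -> I -> R) :
  (forall i, continuous (f i)) -> continuous (fun x => \sum_(i < n) f i x).
Proof. by move=> cf; apply: (@continuous_big _ _ _ _ _ add_continuous). Qed.

Lemma simplex_sum1 p : \sum_(i < n) simplex_val p 0 i = 1.
Proof.
have cl : closed [set y : 'rV[R]_n | \sum_(i < n) y 0 i \in [set 1 : R]].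
  apply: (@preimage_closed _ _ (fun y : 'rV[R]_n => \sum_(i < n) y 0 i)
    [set x | x \in [set 1 : R]]).
    move=> y _; apply: continuous_coord_sum => i z; exact: coord_continuous.
  rewrite (_ : [set x | _] = [set 1]); first exact: closed_eq.
  by apply/seteqP; split=> x /=; rewrite inE.
suff : \sum_(i < n) simplex_val p 0 i \in [set 1 : R] by rewrite inE.
apply/cl/(closureS _ (set_valP p)) => x [_ x1] /=.
by rewrite inE.
Qed.

(** Both sides sum to 1, so no inequality between coordinates can be strict. *)
Lemma simplex_eq p q : (forall i, simplex_val p 0 i <= simplex_val q 0 i) ->
  p = q.
Proof.
move=> pq; apply: val_inj; apply/rowP => i.
have [_] := leif_sum (fun i (_ : true) => leif_eq (pq i)).
rewrite /= !simplex_sum1 eqxx => /esym/forallP/(_ i).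
by move/eqP.
Qed.

Hypothesis n_ge2 : (2 <= n)%N.

Let n_gt0 : 0 < n%:R :> R.
Proof. by rewrite ltr0n ltnW. Qed.

(** With at least two coordinates, positivity and sum 1 keep each of them below
1. *)
Lemma pos_sum1_simplex (x : 'rV[R]_n) : (forall i, 0 < x 0 i) ->
  \sum_(i < n) x 0 i = 1 -> open_simplex x.
Proof.
move=> x0 x1; split=> // i; rewrite x0 /= -x1 (bigD1 i)//= ltrDl.
have [j ji] : exists j : 'I_n, j != i.
  have [->|i0] := eqVneq i (Ordinal (ltnW n_ge2)).
    by exists (Ordinal n_ge2); rewrite -val_eqE.
  by exists (Ordinal (ltnW n_ge2)); rewrite eq_sym.
rewrite (bigD1 j)//= ltr_pwDl// sumr_ge0// => k _; exact: ltW.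
Qed.

Definition center_rV : 'rV[R]_n := const_mx n%:R^-1.

Lemma center_sum : \sum_(i < n) center_rV 0 i = 1.
Proof.
rewrite (eq_bigr (fun=> n%:R^-1)); last by move=> i _; rewrite mxE.
by rewrite sumr_const card_ord -[_ *+ _]mulr_natl divff// gt_eqF.
Qed.

Lemma center_blend_open (x : 'rV[R]_n) (s : R) :
  (forall i, 0 <= x 0 i) -> \sum_(i < n) x 0 i = 1 -> 0 < s <= 1 ->
  open_simplex ((1 - s) *: x + s *: center_rV).
Proof.
move=> x0 x1 /andP[s0 s1]; apply: pos_sum1_simplex => [i|].
  by rewrite !mxE ltr_wpDl// ?mulr_ge0 ?subr_ge0// mulr_gt0// invr_gt0.
under eq_bigr do rewrite mxE [X in X + _]mxE [X in _ + X]mxE.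
by rewrite big_split/= -!mulr_sumr x1 center_sum; ring.
Qed.

(** A nonnegative vector of sum 1 is a limit of interior points, namely of its
convex combinations with the barycenter. *)
Lemma closure_simplexP (x : 'rV[R]_n) : (forall i, 0 <= x 0 i) ->
  \sum_(i < n) x 0 i = 1 -> closure (@open_simplex R n) x.
Proof.
move=> x0 x1 U /nbhs_ballP[e /= e0 eU].
pose s : R := Num.min 1 (e / 2).
have s0 : 0 < s by rewrite lt_min ltr01 divr_gt0.
have s1 : s <= 1 by rewrite ge_min lexx.
have se : s < e by rewrite gt_min ltr_pdivrMr// ltr_pMr// ltr1n orbT.
exists ((1 - s) *: x + s *: center_rV); split.
  by apply: center_blend_open; rewrite ?s0.
apply: eU; split=> // i j; rewrite (ord1 i) -ball_normE /= !mxE.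
have xj : x 0 j <= 1.
  by rewrite -x1 (bigD1 j)//= lerDl sumr_ge0.
have nV : 0 < (n%:R : R)^-1 <= 1.
  by rewrite invr_gt0 n_gt0 invf_le1// ler1n ltnW.
have := x0 j; move/andP: nV => [nV0 nV1] xj0.
rewrite (_ : _ - _ = s * (x 0 j - n%:R^-1)); last by ring.
rewrite normrM gtr0_norm//; apply: le_lt_trans se.
rewrite ger_pMr// ler_norml; apply/andP; split; lra.
Qed.

End simplex_points.

Section concave_functions.
Context {R : realType} {n : nat} (n_ge2 : (2 <= n)%N).
Implicit Types (p q : simplex R n) (psi : simplex R n -> R).

Let n_gt0 : 0 < n%:R :> R.
Proof. by rewrite ltr0n ltnW. Qed.

Lemma center_rV_ge0 i : 0 <= (center_rV : 'rV[R]_n) 0 i.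
Proof. by rewrite mxE invr_ge0 ler0n. Qed.

Definition barycenter : simplex R n := exist _ center_rV
  (mem_set (closure_simplexP n_ge2 center_rV_ge0 (center_sum n_ge2))).

Lemma barycenterE i : simplex_val barycenter 0 i = n%:R^-1.
Proof. by rewrite /simplex_val /= mxE. Qed.

(** The points p with p >= (1 - e) q coordinatewise are those of the form
(1 - e) q + e r with r in the simplex; by concavity psi p is at least
(1 - e) psi q + e psi r, and psi r is nonnegative. *)
Lemma concave_scale psi p q (e : R) :
  (forall p, 0 <= psi p) -> concave psi -> 0 <= e <= 1 ->
  (forall i, (1 - e) * simplex_val q 0 i <= simplex_val p 0 i) ->
  (1 - e) * psi q <= psi p.
Proof.
move=> psi0 cpsi /andP[e0 e1] pq.
have [eE|eN0] := eqVneq e 0.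
  suff -> : p = q by rewrite eE subr0 mul1r.
  by apply/esym/simplex_eq => i; have := pq i; rewrite eE subr0 mul1r.
have egt0 : 0 < e by rewrite lt_neqAle eq_sym eN0.
pose x : 'rV[R]_n := e^-1 *: (simplex_val p - (1 - e) *: simplex_val q).
have x0 i : 0 <= x 0 i.
  by rewrite !mxE mulr_ge0 ?invr_ge0// subr_ge0.
have x1 : \sum_(i < n) x 0 i = 1.
  under eq_bigr do rewrite /x !mxE.
  rewrite -mulr_sumr sumrB -mulr_sumr !simplex_sum1 mulr1 subKr.
  by rewrite mulVf.
pose r : simplex R n := exist _ x (mem_set (closure_simplexP n_ge2 x0 x1)).
have := cpsi q r p (1 - e); rewrite subr_ge0 e1 gerBl e0 subKr => /(_ isT).
move=> /(_ _)/wrap[].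
  apply/rowP => i; rewrite /= /x !mxE mulrA divff// mul1r; ring.
by apply: le_trans; rewrite lerDl mulr_ge0.
Qed.

Lemma concave_le_center psi p : (forall p, 0 <= psi p) -> concave psi ->
  psi p <= n%:R * psi barycenter.
Proof.
move=> psi0 cpsi; rewrite mulrC -ler_pdivrMr// mulrC.
(* The barycenter dominates p / n, since the coordinates of p are at most 1. *)
have nV : 0 < (n%:R^-1 : R) <= 1.
  by rewrite invr_gt0 n_gt0 invf_le1// ler1n ltnW.
have := @concave_scale psi barycenter p (1 - n%:R^-1) psi0 cpsi; rewrite subKr.
move/andP: nV => [nV0 nV1]; apply.
  by rewrite subr_ge0 nV1 gerBl ltW.
move=> i; rewrite barycenterE ger_pMr//.
by have /andP[] := simplex_coord_itv p i.
Qed.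

(** Multiplicative lower closeness holds near every point of the closed simplex:
on the boundary the vanishing coordinates impose no constraint.  With
[concave_scale] this gives lower semicontinuity up to the boundary. *)
Lemma near_scale_le q (e : R) : 0 < e ->
  \forall p \near q, forall i,
    (1 - e) * simplex_val q 0 i <= simplex_val p 0 i.
Proof.
move=> e0; apply: near_forall => i.
have [->|qi] := eqVneq (simplex_val q 0 i) 0.
  by apply: near_always => p; rewrite mulr0 simplex_coord_ge0.
have qi0 : 0 < simplex_val q 0 i by rewrite lt_neqAle eq_sym qi simplex_coord_ge0.
apply: (continuous_near_ge (@continuous_simplex_coord R n i q)).
by rewrite gtr_pMl// gtrBl.
Qed.

Lemma near_le_add q (e : R) : 0 < e ->
  \forall p \near q, forall i,
    simplex_val p 0 i <= simplex_val q 0 i + e.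
Proof.
move=> e0; apply: near_forall => i.
apply: (continuous_near_le (@continuous_simplex_coord R n i q)).
by rewrite ltrDl.
Qed.

End concave_functions.

Section grid_points.
Context {R : realType} {n : nat} (n_ge2 : (2 <= n)%N).
Implicit Types (p q : simplex R n) (psi phi : concave_fun R n).

Let n_gt0 : 0 < n%:R :> R.
Proof. by rewrite ltr0n ltnW. Qed.

(** The grid points are the normalized positive integer vectors: a countable
dense set of interior points that contains the barycenter. *)
Definition grid_rV (v : 'I_n -> nat) : 'rV[R]_n :=
  \row_i ((v i).+1%:R / (\sum_j (v j).+1)%:R).

Lemma grid_rV_gt0 v i : 0 < grid_rV v 0 i.
Proof.
rewrite mxE divr_gt0 ?ltr0n// (bigD1 i)//=.
Qed.

Lemma grid_rV_sum v : \sum_(i < n) grid_rV v 0 i = 1.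
Proof.
under eq_bigr do rewrite mxE.
rewrite -mulr_suml -natr_sum divff// pnatr_eq0 (bigD1 (Ordinal n_ge2))//=.
Qed.

Definition grid v : simplex R n := exist _ (grid_rV v)
  (mem_set (closure_simplexP n_ge2 (fun i => ltW (grid_rV_gt0 v i))
    (grid_rV_sum v))).

Lemma grid_open v : open_simplex (simplex_val (grid v)).
Proof.
by apply: (pos_sum1_simplex n_ge2); [exact: grid_rV_gt0|exact: grid_rV_sum].
Qed.

Lemma grid0 : grid (fun=> 0%N) = barycenter n_ge2.
Proof.
apply: val_inj; apply/rowP => i; rewrite /= !mxE sum_nat_const card_ord muln1.
by rewrite div1r.
Qed.

Lemma barycenter_open : open_simplex (simplex_val (barycenter n_ge2 : simplex R n)).
Proof. by rewrite -grid0; exact: grid_open. Qed.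

(** On a set whose coordinates are bounded below by a > 0, rounding N p up to an
integer vector, with N large, gives a grid point that is multiplicatively close
to p in both directions; only finitely many grid points arise. *)
Lemma grid_approx (a e : R) : 0 < a -> 0 < e ->
  exists N, forall p, (forall i, a <= simplex_val p 0 i) ->
    exists v, [/\ (forall i, v i < N)%N,
      (forall i, (1 - e) * simplex_val p 0 i <= simplex_val (grid v) 0 i) &
      (forall i, (1 - e) * simplex_val (grid v) 0 i <= simplex_val p 0 i)].
Proof.
move=> a0 e0.
(* Rounding changes each coordinate of N p by at most 1 <= e N a and their sum by
   at most n <= e N. *)
pose N := (Num.trunc (n%:R / e + (e * a)^-1)).+1.
have ea0 : 0 < (e * a)^-1 by rewrite invr_gt0 mulr_gt0.
have ne0 : 0 < n%:R / e by rewrite divr_gt0.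
have NP : n%:R / e + (e * a)^-1 < N%:R by exact: truncnS_gt.
have N0 : 0 < (N%:R : R) by rewrite ltr0n.
have Nn : n%:R <= e * N%:R.
  by rewrite -ler_pdivrMl// mulrC ltW//; apply: le_lt_trans NP; rewrite lerDl ltW.
have Na : 1 <= e * a * N%:R.
  rewrite -ler_pdivrMl ?mulr_gt0// mulr1 ltW//; apply: le_lt_trans NP.
  by rewrite lerDr ltW.
exists N.+1 => p pa.
have vN (i : 'I_n) : (Num.trunc (N%:R * simplex_val p 0 i)%R < N.+1)%N.
  have /andP[p0 p1] := simplex_coord_itv p i.
  rewrite truncn_lt_nat ?mulr_ge0//; apply: (@le_lt_trans _ _ N%:R).
    by rewrite ger_pMr.
  by rewrite ltr_nat.
pose v (i : 'I_n) := Num.trunc (N%:R * simplex_val p 0 i).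
exists v.
have v_lo i : N%:R * simplex_val p 0 i <= (v i).+1%:R.
  by rewrite ltW// truncnS_gt.
have v_hi i : (v i).+1%:R <= N%:R * simplex_val p 0 i + 1.
  by rewrite -natr1 lerD2r truncn_le mulr_ge0// simplex_coord_ge0.
pose S : R := (\sum_j (v j).+1)%:R.
have S_lo : N%:R <= S.
  have -> : N%:R = \sum_i N%:R * simplex_val p 0 i :> R.
    by rewrite -mulr_sumr simplex_sum1 mulr1.
  rewrite /S natr_sum.
  by apply: ler_sum => i _; exact: v_lo.
have S_hi : S <= N%:R + n%:R.
  rewrite /S natr_sum; apply: le_trans (ler_sum _ (fun i _ => v_hi i)) _.
  by rewrite big_split/= -mulr_sumr simplex_sum1 mulr1 sumr_const card_ord.
have S0 : 0 < S by exact: lt_le_trans S_lo.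
have gE i : simplex_val (grid v) 0 i = (v i).+1%:R / S by rewrite mxE.
split=> // i; rewrite gE.
- rewrite ler_pdivlMr//; apply: le_trans (v_lo i).
  have p0 := simplex_coord_ge0 p i.
  rewrite -mulrA [in leLHS]mulrCA [in leRHS]mulrC ler_wpM2l//.
  have [e1|e1] := leP e 1; last first.
    apply: (@le_trans _ _ 0) => //; rewrite pmulr_lle0// subr_le0 ltW//.
  apply: (@le_trans _ _ ((1 - e) * (N%:R + n%:R))).
    by rewrite ler_wpM2l// subr_ge0.
  nra.
- rewrite mulrA ler_pdivrMr//.
  have [e1|e1] := leP e 1; last first.
    apply: (@le_trans _ _ 0); last by rewrite mulr_ge0 ?simplex_coord_ge0// ltW.
    by rewrite pmulr_lle0 ?ltr0n// subr_le0 ltW.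
  apply: (@le_trans _ _ (simplex_val p 0 i * N%:R)); last first.
    by rewrite ler_wpM2l// simplex_coord_ge0.
  apply: (@le_trans _ _ ((1 - e) * (N%:R * simplex_val p 0 i + 1))).
    by rewrite ler_wpM2l// subr_ge0.
  have := pa i; nra.
Qed.

(** The coordinates are continuous and positive on the set, so they attain
positive minima. *)
Lemma inner_compact_coord_ge (A : set (simplex R n)) : inner_compact A ->
  exists2 a : R, 0 < a & forall p, A p -> forall i, a <= simplex_val p 0 i.
Proof.
move=> [cA sA].
have [->|/set0P A0] := eqVneq A set0; first by exists 1.
have /choice[m mP] (i : 'I_n) : exists a : R, 0 < a /\
    forall p, A p -> a <= simplex_val p 0 i.
  have [|c cA' cP] := @compact_EVT_min _ _
    (fun p : simplex R n => simplex_val p 0 i) A A0 cA.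
    by apply: continuous_subspaceT; exact: continuous_simplex_coord.
  exists (simplex_val c 0 i); split.
    by move: cA' => /set_mem/sA[/(_ i)/andP[]].
  by move=> p pA; apply: cP; rewrite inE.
exists (\big[Num.min/1]_i m i).
  by apply: (big_ind (fun x => 0 < x)) => [//|x y x0 y0|i _];
    [rewrite lt_min x0|have [] := mP i].
move=> p pA i; apply: (@le_trans _ _ (m i)); first exact: bigmin_le_cond.
by have [_] := mP i; apply.
Qed.

End grid_points.

Section topology.
Context {R : realType} {n : nat} (n_ge2 : (2 <= n)%N).
Implicit Types (p q : simplex R n) (psi phi : concave_fun R n).

Lemma concave_fun_ge0 psi p : 0 <= psi p.
Proof. by have [_ + _] := set_mem (valP psi); apply. Qed.

Lemma concave_fun_concave psi : concave psi.
Proof. by have [] := set_mem (valP psi). Qed.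

Lemma concave_fun_scale psi p q (e : R) : 0 <= e <= 1 ->
  (forall i, (1 - e) * simplex_val q 0 i <= simplex_val p 0 i) ->
  (1 - e) * psi q <= psi p.
Proof.
apply: (concave_scale n_ge2); first exact: concave_fun_ge0.
exact: concave_fun_concave.
Qed.

Lemma concave_fun_le_center psi p : psi p <= n%:R * psi (barycenter n_ge2).
Proof.
apply: concave_le_center; first exact: concave_fun_ge0.
exact: concave_fun_concave.
Qed.

Let close psi (N : nat) (e : R) phi := forall v : 'I_n -> nat,
  (forall i, v i < N)%N -> `|psi (grid n_ge2 v) - phi (grid n_ge2 v)| < e.

(** Each point of an inner compact set is multiplicatively close to a grid
point, so a concave function is controlled there by its values at finitely many
grid points. *)
Lemma grid_uniform psi (A : set (simplex R n)) (e : R) :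
  inner_compact A -> 0 < e ->
  exists N d, 0 < d /\ forall phi, close psi N d phi ->
    forall p, A p -> `|psi p - phi p| < e.
Proof.
move=> /inner_compact_coord_ge[a a0 aA] e0.
(* B bounds psi, and also phi at the grid points where phi is within 1 of psi. *)
pose B := n%:R * psi (barycenter n_ge2) + 1.
have B0 : 0 < B by rewrite ltr_wpDl// mulr_ge0// concave_fun_ge0.
pose t := Num.min 2^-1 (e / (8 * B)).
have t0 : 0 < t by rewrite lt_min invr_gt0 ltr0n/= divr_gt0// mulr_gt0.
have t_half : t <= 2^-1 by rewrite ge_min lexx.
have tB : 4 * t * B <= e / 2.
  have : t <= e / (8 * B) by rewrite ge_min lexx orbT.
  by rewrite ler_pdivlMr ?mulr_gt0//; lra.
have [N NP] := grid_approx n_ge2 a0 t0.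
pose d := Num.min 1 (e / 4).
have d0 : 0 < d by rewrite lt_min ltr01/= divr_gt0.
have d1 : d <= 1 by rewrite ge_min lexx.
have de : d <= e / 4 by rewrite ge_min lexx orbT.
exists N, d; split=> // phi cphi p pA.
have [v [vN vp pv]] := NP p (aA p pA).
have := cphi v vN; set q := grid n_ge2 v in vp pv *.
have t01 : 0 <= t <= 1 by rewrite (ltW t0)/=; lra.
have h1 := concave_fun_scale psi t01 vp.
have h2 := concave_fun_scale psi t01 pv.
have h3 := concave_fun_scale phi t01 vp.
have h4 := concave_fun_scale phi t01 pv.
have qB : psi q <= B - 1.
  by rewrite /B addrK; exact: concave_fun_le_center.
have pB : psi p <= B - 1.
  by rewrite /B addrK; exact: concave_fun_le_center.
have := concave_fun_ge0 phi p; have := concave_fun_ge0 phi q.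
move=> q0 p0; rewrite !ltr_norml => /andP[l1 l2].
have phiqB : phi q <= B by lra.
have phip : phi p <= phi q + 2 * t * phi q.
  have : phi p * 2^-1 <= phi q.
    apply: le_trans h3; rewrite mulrC ler_wpM2r//; lra.
  by move=> ?; nra.
have tq : t * phi q <= t * B by rewrite ler_wpM2l// ltW.
have tp1 : t * psi p <= t * B by rewrite ler_wpM2l ?ltW//; lra.
have tq1 : t * psi q <= t * B by rewrite ler_wpM2l ?ltW//; lra.
apply/andP; split; lra.
Qed.

(** The topology of locally uniform convergence is thus that of pointwise
convergence on the countable set of grid points. *)
Lemma concave_fun_grid_nbhs psi (U : set (concave_fun R n)) : nbhs psi U ->
  exists N e, 0 < e /\ forall phi, close psi N e phi -> U phi.
Proof.
case=> _ /= [[W oW <-] Wpsi sU].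
(* The sets containing all functions close to psi at finitely many grid points
   form a filter, which converges to psi uniformly on each inner compact set. *)
pose F : set_system (simplex R n -> R) := fun W =>
  exists N e, 0 < e /\ forall phi, close psi N e phi -> W phi.
have FF : Filter F.
  split=> [|P Q [N [e [e0 eP]]] [M [d [d0 dQ]]]|P Q PQ [N [e [e0 eP]]]].
  - by exists 0%N, 1.
  - exists (maxn N M), (Num.min e d); split; first by rewrite lt_min e0.
    move=> phi c; split.
      apply: eP => v vN; apply: lt_le_trans (c v _) _.
        by move=> i; rewrite leq_max vN.
      by rewrite ge_min lexx.
    apply: dQ => v vN; apply: lt_le_trans (c v _) _.
      by move=> i; rewrite leq_max vN orbT.
    by rewrite ge_min lexx orbT.
  - by exists N, e; split=> // phi c; exact/PQ/eP.
have FW : F W.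
  have : {family @inner_compact R n, F --> set_val psi}.
    apply/fam_cvgP => A cA P /uniform_nbhs[E [+ EP]].
    rewrite -entourage_ballE => -[e /= e0 eE].
    have [N [d [d0 H]]] := grid_uniform psi cA e0.
    exists N, d; split=> // phi c; apply: EP => p pA; apply: eE => /=.
    by rewrite -ball_normE; exact: H.
  by apply; exact: open_nbhs_nbhs.
have [N [e [e0 eW]]] := FW.
by exists N, e; split=> // phi c; apply: sU; exact: eW.
Qed.

Lemma continuous_concave_fun_val :
  continuous (fun psi => set_val psi : {family @inner_compact R n, simplex R n -> R}).
Proof. exact: (@initial_continuous _ _ (set_val : @concave_set R n -> _)). Qed.

Lemma continuous_concave_eval p : open_simplex (simplex_val p) ->
  continuous (fun psi => psi p).
Proof.
move=> op; apply: continuous_dist => psi e e0.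
have cA : @inner_compact R n [set p].
  by split; [exact: compact_set1|move=> _ ->].
have : nbhs (set_val psi : {family @inner_compact R n, simplex R n -> R})
    [set g | forall y, [set p] y -> ball (set_val psi y) e (g y)].
  apply: (fam_nbhs (E := [set xy : R * R | ball xy.1 e xy.2]) _ _ cA).
  by rewrite -entourage_ballE; exists e.
move=> /continuous_concave_fun_val.
by apply: near_mono => phi /(_ p erefl); rewrite -ball_normE.
Qed.

(** A random concave function is Borel as soon as its values at the grid points
are random variables. *)
Lemma measurable_concave_fun d (T : measurableType d)
    (X : T -> borel (concave_fun R n)) :
  (forall v, measurable_fun setT (fun w => (X w : concave_fun R n) (grid n_ge2 v))) ->
  measurable_fun setT X.
Proof.
move=> mX; have := @measurability _ _ T (borel (concave_fun R n)) setT X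
  (@open (concave_fun R n)) erefl.
apply; move=> _ [U oU <-]; rewrite setTI.
(* S N is the event that closeness at the grid points of index below N already
   keeps the random function inside U. *)
pose S N : set T := [set w | exists2 e : R, 0 < e & forall w',
  (forall v : {ffun 'I_n -> 'I_N},
    `|(X w : concave_fun R n) (grid n_ge2 (fun i => v i)) -
      (X w' : concave_fun R n) (grid n_ge2 (fun i => v i))| < e) -> U (X w')].
rewrite (_ : _ @^-1` _ = \bigcup_N S N); last first.
  apply/seteqP; split=> [w Uw|w [N _ [e e0]]]; last first.
    by apply=> v; rewrite subrr normr0.
  have [N [e [e0 eU]]] : exists N e, 0 < e /\
      forall phi, close (X w : concave_fun R n) N e phi -> U phi.
    by apply: concave_fun_grid_nbhs; exact: open_nbhs_nbhs.
  exists N => //; exists e => // w' ww'; apply: eU => v vN.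
  rewrite (_ : v = fun i => [ffun i => Ordinal (vN i)] i) ?ww'//.
  by apply/funext => i; rewrite ffunE.
apply: bigcup_measurable => N _.
apply: (@locally_determined_measurable _ _ _ {ffun 'I_n -> 'I_N}
  (fun w v => (X w : concave_fun R n) (grid n_ge2 (fun i => v i)))) => //.
move=> w [e e0 eS]; exists (e / 2); first by rewrite divr_gt0.
move=> w' ww'; exists (e / 2); first by rewrite divr_gt0.
move=> w'' w'w''; apply: eS => v.
by rewrite (splitr e); apply: le_lt_trans (ler_distD _ _ _) (ltrD (ww' v) (w'w'' v)).
Qed.

End topology.

(** * Functions determined by countably many tests *)

Section limits_of_tests.
Context {R : realType} {n : nat} (n_ge2 : (2 <= n)%N).
Implicit Types (p q : simplex R n) (psi phi : concave_fun R n).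

(** The pairs of a grid point and a rational level form a countable set.  A number
that encodes no pair stands for the barycenter and the level 0. *)
Definition test (i : nat) : {ffun 'I_n -> nat} * rat :=
  odflt ([ffun=> 0%N], 0) (unpickle i).

Definition test_point i : simplex R n := grid n_ge2 (test i).1.

Definition test_level i : R := ratr (test i).2.

Lemma test_surj v (x : rat) :
  exists i, test_point i = grid n_ge2 v /\ test_level i = ratr x.
Proof.
exists (pickle (finfun v, x)); rewrite /test_point /test_level /test pickleK /=.
by split=> //; congr grid; apply/funext => i; rewrite ffunE.
Qed.

Definition passes psi i : bool := test_level i < psi (test_point i).

Definition agrees (b : nat -> bool) (m : nat) : set (concave_fun R n) :=
  [set psi | forall i, (i < m)%N -> passes psi i = b i].

Lemma agrees_decr b m k : (m <= k)%N -> agrees b k `<=` agrees b m.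
Proof. by move=> mk psi H i im; apply: H; exact: leq_trans mk. Qed.

Definition tests_converge b psi := forall U, nbhs psi U ->
  exists m, agrees b m `<=` U.

(** Evaluation at a test point is continuous, so strict inequalities at the limit
would hold for the functions with these answers too; equality can occur for
either answer. *)
Lemma tests_converge_level b psi i : (forall m, agrees b m !=set0) ->
  tests_converge b psi ->
  if b i then test_level i <= psi (test_point i)
  else psi (test_point i) <= test_level i.
Proof.
move=> b0 bpsi; case: ifPn => [bi|/negbTE bi]; rewrite leNgt; apply/negP => lt.
- have [|m mU] := bpsi [set phi | phi (test_point i) < test_level i].
    apply: (@open_nbhs_nbhs (concave_fun R n)); split=> //.
    apply: (@open_comp _ _ (fun phi => phi (test_point i)) [set x | x < _]).
      move=> phi _; apply: continuous_concave_eval; exact: grid_open.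
    exact: open_lt.
  have [phi bphi] := b0 (maxn m i.+1).
  have := mU phi (agrees_decr (leq_maxl _ _) bphi) => /=.
  have := bphi i; rewrite leq_max ltnSn orbT => /(_ isT); rewrite /passes bi.
  by move=> lt1 lt2; have := lt_trans lt1 lt2; rewrite ltxx.
- have [|m mU] := bpsi [set phi | test_level i < phi (test_point i)].
    apply: (@open_nbhs_nbhs (concave_fun R n)); split=> //.
    apply: (@open_comp _ _ (fun phi => phi (test_point i)) [set x | _ < x]).
      move=> phi _; apply: continuous_concave_eval; exact: grid_open.
    exact: open_gt.
  have [phi bphi] := b0 (maxn m i.+1).
  have := mU phi (agrees_decr (leq_maxl _ _) bphi) => /=.
  have := bphi i; rewrite leq_max ltnSn orbT => /(_ isT); rewrite /passes bi.
  by move=> ->.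
Qed.

Section construction.
Variables (b : nat -> bool) (i0 : nat).
Hypothesis b_inh : forall m, agrees b m !=set0.
Hypothesis i0_center : test_point i0 = barycenter n_ge2.
Hypothesis b_i0 : ~~ b i0.

Let n_gt0 : 0 < n%:R :> R.
Proof. by rewrite ltr0n ltnW. Qed.

Let I m p : R := inf [set psi p | psi in agrees b m].

Let I_le m p psi : agrees b m psi -> I m p <= psi p.
Proof.
move=> ag; apply: ge_inf; last by exists psi.
by exists 0 => _ [phi _ <-]; exact: concave_fun_ge0.
Qed.

Let I_ge m p x : (forall psi, agrees b m psi -> x <= psi p) -> x <= I m p.
Proof.
move=> H; apply: lb_le_inf; last by move=> _ [phi ag <-]; exact: H.
by have [psi ag] := b_inh m; exists (psi p); exists psi.
Qed.

Let I_mono m k p : (m <= k)%N -> I m p <= I k p.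
Proof. by move=> mk; apply: I_ge => psi /(agrees_decr mk)/I_le. Qed.

(** The failed test at the barycenter bounds all functions with these answers. *)
Let I_bound m p : I m p <= n%:R * test_level i0.
Proof.
apply: le_trans (I_mono p (leq_maxl m i0.+1)) _.
have [psi ag] := b_inh (maxn m i0.+1).
apply: le_trans (I_le _ ag) _; apply: le_trans (concave_fun_le_center n_ge2 _ _) _.
rewrite ler_pM2l// -i0_center leNgt.
by rewrite -/(passes psi i0) ag ?b_i0// leq_max ltnSn orbT.
Qed.

(** The pointwise lower limit along the sets of functions agreeing with b; lower
limits of concave functions are concave. *)
Let L p : R := sup (range (I ^~ p)).

Let L_ge m p : I m p <= L p.
Proof.
apply: ub_le_sup; last by exists m.
by exists (n%:R * test_level i0) => _ [k _ <-]; exact: I_bound.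
Qed.

Let L_le p x : (forall m, I m p <= x) -> L p <= x.
Proof.
move=> H; apply: ge_sup; first by exists (I 0 p); exists 0%N.
by move=> _ [k _ <-]; exact: H.
Qed.

Let L_ge0 p : 0 <= L p.
Proof.
by apply: le_trans (L_ge 0 p); apply: I_ge => psi _; exact: concave_fun_ge0.
Qed.

(** A supremum may be taken inside an affine inequality with nonnegative slope. *)
Let L_lin p t c x : 0 <= t -> (forall m, t * I m p + c <= x) -> t * L p + c <= x.
Proof.
move=> t0 H; have [tE|tN] := eqVneq t 0.
  by have := H 0%N; rewrite tE !mul0r.
have {tN}t0 : 0 < t by rewrite lt_neqAle eq_sym tN.
rewrite -lerBrDr -ler_pdivlMl//; apply: L_le => m.
by rewrite ler_pdivlMl// lerBrDr.
Qed.

Let L_concave : concave L.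
Proof.
move=> p q r t /andP[t0 t1] rE.
apply: L_lin => // m; rewrite addrC; apply: L_lin; first by rewrite subr_ge0.
move=> k; rewrite addrC; apply: le_trans (L_ge (maxn m k) r).
apply: I_ge => psi ag.
have t01 : 0 <= t <= 1 by rewrite t0.
apply: le_trans (concave_fun_concave psi t01 rE); apply: lerD.
  by rewrite ler_wpM2l//; apply: I_le; exact: agrees_decr (leq_maxl _ _) _ ag.
rewrite ler_wpM2l ?subr_ge0//; apply: I_le; exact: agrees_decr (leq_maxr _ _) _ ag.
Qed.

Let L_scale p q (e : R) : 0 <= e <= 1 ->
  (forall i, (1 - e) * simplex_val q 0 i <= simplex_val p 0 i) ->
  (1 - e) * L q <= L p.
Proof. exact: concave_scale. Qed.

Let s (k : nat) : R := k.+2%:R^-1.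

Let s_gt0 k : 0 < s k. Proof. by rewrite invr_gt0. Qed.

Let s_lt1 k : s k < 1. Proof. by rewrite invf_lt1// ltr1n. Qed.

Let s1_gt0 k : 0 < 1 - s k. Proof. by rewrite subr_gt0. Qed.

Let blend_closure k p : closure (@open_simplex R n)
  ((1 - s k) *: simplex_val p + s k *: center_rV).
Proof.
apply/subset_closure/(center_blend_open n_ge2).
- exact: simplex_coord_ge0.
- exact: simplex_sum1.
- by rewrite s_gt0 ltW.
Qed.

Let blend k p : simplex R n := 
  exist _ ((1 - s k) *: simplex_val p + s k *: center_rV)
    (mem_set (@blend_closure k p)).

Let blendE k p i : simplex_val (blend k p) 0 i =
  (1 - s k) * simplex_val p 0 i + s k * n%:R^-1.
Proof. by rewrite /simplex_val /= !mxE. Qed.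

(** Pointwise lower limits are well behaved in the open simplex only; the value
at any other point is read off along the segment to the barycenter.  Each
quotient depends on L at interior points, so it is upper semicontinuous in p, and
hence so is the infimum; being concave, the infimum is lower semicontinuous as
well. *)
Let limit p : R := inf (range (fun k => L (blend k p) / (1 - s k))).

Let limit_le k p : limit p <= L (blend k p) / (1 - s k).
Proof.
apply: ge_inf; last by exists k.
by exists 0 => _ [j _ <-]; rewrite divr_ge0// ltW.
Qed.

Let limit_ge p x : (forall k, x <= L (blend k p) / (1 - s k)) -> x <= limit p.
Proof.
move=> H; apply: lb_le_inf; last by move=> _ [k _ <-].
by exists (L (blend 0 p) / (1 - s 0)); exists 0%N.
Qed.

Let limit_ge0 p : 0 <= limit p.
Proof. by apply: limit_ge => k; rewrite divr_ge0// ltW. Qed.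

Let limit_concave : concave limit.
Proof.
move=> p q r t /andP[t0 t1] rE; apply: limit_ge => k.
apply: (@le_trans _ _
    ((t * L (blend k p) + (1 - t) * L (blend k q)) / (1 - s k))).
  by rewrite [leRHS]mulrDl -!mulrA lerD// ler_wpM2l ?subr_ge0.
rewrite ler_pM2r ?invr_gt0//; apply: L_concave; first by rewrite t0.
apply/rowP => i.
have rEi : simplex_val r 0 i =
    t * simplex_val p 0 i + (1 - t) * simplex_val q 0 i by rewrite rE !mxE.
rewrite [RHS]mxE [X in _ = X + _]mxE [X in _ = _ + X]mxE !blendE rEi; ring.
Qed.

Let limit_continuous : continuous limit.
Proof.
apply: continuous_dist => q e e0.
pose B := n%:R * limit (barycenter n_ge2).
have limB p : limit p <= B by exact: concave_le_center.
have B0 : 0 <= B by rewrite mulr_ge0// ltW.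
pose d := Num.min 1 (e / (4 * (B + 1))).
have B4 : 0 < 4 * (B + 1) by lra.
have d0 : 0 < d by rewrite lt_min ltr01/= divr_gt0.
have d01 : 0 <= d <= 1 by rewrite ltW// ge_min lexx.
have dB : 4 * d * B <= e.
  have : d <= e / (4 * (B + 1)) by rewrite ge_min lexx orbT.
  rewrite ler_pdivlMr//; nra.
(* Upper bound: choose a point of the segment that nearly realizes limit q; the
   corresponding point for p is multiplicatively close to it. *)
have [_ [k _ <-] kP] : exists2 x, range (fun k => L (blend k q) / (1 - s k)) x &
    x < limit q + e / 2.
  apply: inf_adherent; first by rewrite divr_gt0.
  split; first by exists (L (blend 0 q) / (1 - s 0)); exists 0%N.
  by exists 0 => _ [j _ <-]; rewrite divr_ge0// ltW.
have ds0 : 0 < d * s k * n%:R^-1 by rewrite !mulr_gt0// invr_gt0.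
move: (near_scale_le q d0) (near_le_add q ds0).
apply: near_mono2 => p H1 H2.
have l1 : (1 - d) * limit q <= limit p by exact: concave_scale.
have : (1 - d) * L (blend k p) <= L (blend k q).
  apply: L_scale => // i; rewrite !blendE.
  have := H2 i; have := s_lt1 k; have := s_gt0 k.
  set a := n%:R^-1; have a0 : 0 < a by rewrite invr_gt0.
  set x := simplex_val p 0 i; set y := simplex_val q 0 i => s0 s1 xy.
  have y0 : 0 <= y by exact: simplex_coord_ge0.
  have sa0 : 0 < s k * a by rewrite mulr_gt0.
  have d1 : 0 <= 1 - d by rewrite subr_ge0; case/andP: d01.
  apply: (@le_trans _ _ ((1 - d) * ((1 - s k) * (y + d * s k * a) + s k * a))).
    by rewrite ler_wpM2l// lerD2r ler_wpM2l// subr_ge0 ltW.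
  rewrite -(mulrA d).
  have : 0 <= (1 - d) * s k * (d * (s k * a)) by rewrite !mulr_ge0// ltW.
  have : 0 <= d * ((1 - s k) * y) by rewrite !mulr_ge0// ltW// subr_gt0.
  have : 0 <= d * d * (s k * a) by rewrite !mulr_ge0// ltW.
  nra.
have := limit_le k p; rewrite ler_pdivlMr// => l2 l3.
have : (1 - d) * limit p < limit q + e / 2.
  apply: le_lt_trans kP; rewrite ler_pdivlMr// -mulrA.
  apply: le_trans l3; rewrite ler_wpM2l// subr_ge0.
  by case/andP: d01.
have dq : d * limit q <= d * B by rewrite ler_wpM2l// ltW.
have dp : d * limit p <= d * B by rewrite ler_wpM2l// ltW.
move=> l4; rewrite ltr_norml; apply/andP; split; lra.
Qed.

(** In the open simplex the points of the segment are multiplicatively close to p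
in both directions. *)
Let limit_open p : open_simplex (simplex_val p) -> limit p = L p.
Proof.
move=> op; apply/eqP; rewrite eq_le; apply/andP; split; last first.
  apply: limit_ge => k; rewrite ler_pdivlMr// mulrC; apply: L_scale.
    by rewrite !ltW.
  by move=> i; rewrite blendE lerDl mulr_ge0// ?invr_ge0 ltW.
have cA : @inner_compact R n [set p].
  by split; [exact: compact_set1|move=> _ ->].
have [a a0 /(_ p erefl) pa] := inner_compact_coord_ge cA.
apply/ler_addgt0Pr => e e0.
pose d := Num.min 1 (e / (2 * (limit p + 1))).
have lp := limit_ge0 p.
have lp2 : 0 < 2 * (limit p + 1) by lra.
have d0 : 0 < d by rewrite lt_min ltr01/= divr_gt0.
have d1 : d <= 1 by rewrite ge_min lexx.
have dl : 2 * d * limit p <= e.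
  have : d <= e / (2 * (limit p + 1)) by rewrite ge_min lexx orbT.
  rewrite ler_pdivlMr//; nra.
have da0 : 0 < d * Num.min a 1 by rewrite mulr_gt0// lt_min a0 ltr01.
pose k := Num.trunc (d * Num.min a 1)^-1.
have sk : s k <= d * Num.min a 1.
  rewrite invf_ple ?posrE//; apply: le_trans (ltW (truncnS_gt _)) _.
  by rewrite ler_nat.
have sd : s k <= d.
  by apply: le_trans sk _; rewrite ger_pMr// ge_min lexx orbT.
have sa : s k <= d * a.
  by apply: le_trans sk _; rewrite ler_pM2l// ge_min lexx.
have l1 : (1 - d) * L (blend k p) <= L p.
  apply: L_scale; first by rewrite ltW.
  move=> i; rewrite blendE.
  have : s k * n%:R^-1 <= d * simplex_val p 0 i.
    apply: (@le_trans _ _ (s k)).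
      by rewrite ger_pMr// invf_le1// ler1n ltnW.
    by apply: le_trans sa _; rewrite ler_pM2l.
  have := simplex_coord_ge0 p i.
  have : 0 <= s k * n%:R^-1 by rewrite mulr_ge0// ?invr_ge0 ltW.
  have := s_gt0 k; have := s_lt1 k.
  set x := s k * _; set y := simplex_val p 0 i => s1 s0 x0 y0 xy.
  have : 0 <= (1 - d) * (s k * y) by rewrite !mulr_ge0 ?subr_ge0// ltW.
  have : 0 <= d * x by rewrite mulr_ge0// ltW.
  nra.
have := limit_le k p; rewrite ler_pdivlMr// => l2.
have l3 : (1 - d) * (limit p * (1 - s k)) <= L p.
  by apply: le_trans l1; rewrite ler_wpM2l// subr_ge0.
have : (1 - d) * (limit p * (1 - s k)) >= (1 - d) * (limit p * (1 - d)).
  by rewrite ler_wpM2l ?subr_ge0// ler_wpM2l// lerD2l lerN2.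
have : 0 <= d * d * limit p by rewrite !mulr_ge0// ltW.
nra.
Qed.

Let limit_in : (limit : {family @inner_compact R n, simplex R n -> R}) \in
  @concave_set R n.
Proof. by rewrite inE; split. Qed.

(** From below by the definition of L; from above because a rational level just
above L p cannot be passed by all functions with these answers. *)
Let limit_grid v e : 0 < e -> exists m, forall psi, agrees b m psi ->
  `|limit (grid n_ge2 v) - psi (grid n_ge2 v)| < e.
Proof.
move=> e0; set p := grid n_ge2 v; rewrite limit_open; last exact: grid_open.
have [_ [m _ <-] mP] : exists2 x, range (I ^~ p) x & L p - e < x.
  apply: sup_adherent => //; split; first by exists (I 0 p); exists 0%N.
  by exists (n%:R * test_level i0) => _ [k _ <-]; exact: I_bound.
have /rat_in_itvoo[x] : L p < L p + e by rewrite ltrDl.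
rewrite in_itv/= => /andP[x1 x2].
have [i [iv ix]] := test_surj v x.
exists (maxn m i.+1) => psi ag.
have h1 : L p - e < psi p.
  apply: lt_le_trans mP _; apply: I_le; exact: agrees_decr (leq_maxl _ _) _ ag.
have bi : ~~ b i.
  apply/negP => bi; have := L_ge i.+1 p; apply/negP; rewrite -ltNge.
  apply: lt_le_trans x1 _; apply: I_ge => phi /(_ i (ltnSn i)).
  by rewrite bi /passes iv ix => /ltW.
have := ag i; rewrite leq_max ltnSn orbT => /(_ isT).
rewrite (negbTE bi) /passes iv ix => /negbT; rewrite -leNgt -/p => h2.
rewrite ltr_norml; apply/andP; split; lra.
Qed.

(** A sequence of answers each of whose initial parts is realized by some concave
function, and which bounds the value at the barycenter, determines a concave
function. *)
Lemma tests_limit_exists : exists psi, tests_converge b psi.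
Proof.
exists (exist _ limit limit_in) => U /(concave_fun_grid_nbhs n_ge2)[N [e [e0 eU]]].
have /choice[m mP] (v : {ffun 'I_n -> 'I_N}) := limit_grid (fun i => v i) e0.
exists (\max_v m v) => psi ag; apply: eU => v vN.
rewrite (_ : v = fun i => [ffun i => Ordinal (vN i)] i); last first.
  by apply/funext => i; rewrite ffunE.
by apply: mP; apply: agrees_decr ag; exact: leq_bigmax.
Qed.

End construction.

End limits_of_tests.

(** * Random bits with prescribed laws *)

Section real_probability.
Context {d} {T : measurableType d} {R : realType} (P : probability T R).

Definition prob (A : set T) : R := fine (P A).

Lemma probE A : measurable A -> P A = (prob A)%:E.
Proof. by move=> mA; rewrite /prob fineK// fin_num_measure. Qed.

Lemma prob_ge0 A : 0 <= prob A.
Proof. exact: fine_ge0. Qed.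

Lemma probT : prob setT = 1.
Proof. by rewrite /prob probability_setT. Qed.

Lemma le_prob A B : measurable A -> measurable B -> A `<=` B ->
  prob A <= prob B.
Proof.
by move=> mA mB AB; rewrite -lee_fin -!probE// le_measure// inE.
Qed.

Lemma prob_le1 A : measurable A -> prob A <= 1.
Proof. by move=> mA; rewrite -probT; apply: le_prob. Qed.

Lemma probU A B : measurable A -> measurable B -> A `&` B = set0 ->
  prob (A `|` B) = prob A + prob B.
Proof.
move=> mA mB AB; apply: EFin_inj; rewrite EFinD -!probE ?measureU//.
exact: measurableU.
Qed.

Lemma probDI A B : measurable A -> measurable B ->
  prob A = prob (A `&` ~` B) + prob (A `&` B).
Proof.
move=> mA mB; apply: EFin_inj.
have mD : measurable (A `&` ~` B) by apply: measurableI => //; exact: measurableC.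
have mI : measurable (A `&` B) by exact: measurableI.
by rewrite EFinD -!probE// (measureDI P mA mB) setDE.
Qed.

Lemma probIC A B : measurable A -> measurable B ->
  prob (A `&` ~` B) = prob A - prob (A `&` B).
Proof. by move=> mA mB; rewrite (probDI mA mB) addrK. Qed.

(** The law of a variable with values in a finite list is the sum of its point
masses. *)
Lemma prob_mem_seq (I : eqType) (f : T -> I) (l : seq I) :
  (forall i, measurable [set x | f x = i]) -> uniq l ->
  measurable [set x | f x \in l] /\
  prob [set x | f x \in l] = \sum_(i <- l) prob [set x | f x = i].
Proof.
move=> mf; elim: l => [_|i l IH /= /andP[il ul]].
  rewrite big_nil (_ : [set x | _] = set0); last by apply/seteqP; split.
  by rewrite /prob measure0.
have [mfl fl] := IH ul.
have -> : [set x | f x \in i :: l] = [set x | f x = i] `|` [set x | f x \in l].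
  apply/seteqP; split=> x /=; first by rewrite inE => /orP[/eqP->|->]; [left|right].
  by move=> [->|xl]; rewrite inE ?eqxx// xl orbT.
split; first exact: measurableU.
rewrite big_cons probU ?fl//; apply/seteqP; split=> // x /= [-> il'].
by rewrite il' in il.
Qed.

End real_probability.

Section histories.

(** Latest value first, so that one more value is a cons. *)
Fixpoint history (b : nat -> bool) (m : nat) : seq bool :=
  if m is k.+1 then b k :: history b k else [::].

Lemma size_history b m : size (history b m) = m.
Proof. by elim: m => //= m ->. Qed.

Lemma eq_history b b' m : history b m = history b' m <->
  (forall i, (i < m)%N -> b i = b' i).
Proof.
elim: m => [|m IH] /=; first by split.
split=> [[bm /IH H] i|H].
  by rewrite ltnS leq_eqVlt => /predU1P[->//|/H].
congr cons; first exact: H.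
by apply/IH => i im; apply: H; exact: ltnW.
Qed.

Definition strings m : seq (seq bool) := map val (enum {: m.-tuple bool}).

Lemma uniq_strings m : uniq (strings m).
Proof. by rewrite map_inj_uniq ?enum_uniq//; exact: val_inj. Qed.

Lemma mem_strings m s : (s \in strings m) = (size s == m).
Proof.
apply/mapP/eqP => [[t _ ->]|sm]; first exact: size_tuple.
by exists (tcast sm (in_tuple s)); rewrite ?mem_enum//= val_tcast.
Qed.

Lemma prob_history d (T : measurableType d) (R : realType) (P : probability T R)
    (b : T -> nat -> bool) m (V : pred (seq bool)) :
  (forall s, measurable [set x | history (b x) (size s) = s]) ->
  measurable [set x | V (history (b x) m)] /\
  prob P [set x | V (history (b x) m)] = \sum_(s <- strings m | V s)
    prob P [set x | history (b x) (size s) = s].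
Proof.
move=> mb; have bm s : s \in strings m ->
    [set x | history (b x) m = s] = [set x | history (b x) (size s) = s].
  by rewrite mem_strings => /eqP ->.
have mbm s : measurable [set x | history (b x) m = s].
  have [sm|sm] := boolP (s \in strings m); first by rewrite bm.
  rewrite (_ : [set x | _] = set0); first exact: measurable0.
  by apply/seteqP; split=> // x /= xs; rewrite mem_strings -xs size_history eqxx in sm.
have [] := prob_mem_seq P mbm (filter_uniq V (uniq_strings m)).
rewrite (_ : [set x | _] = [set x | V (history (b x) m)]); last first.
  by apply/seteqP; split=> x /=;
    rewrite mem_filter mem_strings size_history eqxx andbT.
move=> mV ->; split=> //; rewrite big_filter big_seq_cond [RHS]big_seq_cond.
by apply: eq_bigr => s /andP[/bm-> _].
Qed.

End histories.

Section random_bits.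
Context {R : realType} (w : seq bool -> R).
Hypothesis w_nil : w [::] = 1.
Hypothesis w_ge0 : forall s, 0 <= w s.
Hypothesis w_split : forall s, w s = w (false :: s) + w (true :: s).

(** Cut [0, 1) into half-open intervals of lengths w [:: false] and
w [:: true], and go on cutting the interval of s in the proportion of
w (false :: s) to w (true :: s).  A history of weight 0 gets an empty interval, so
every point of [0, 1) has a history of positive weight. *)
Fixpoint left_end (s : seq bool) : R :=
  if s is b :: s' then left_end s' + (if b then w (false :: s') else 0) else 0.

Fixpoint bits (u : R) (m : nat) : seq bool :=
  if m is k.+1 then
    let s := bits u k in (left_end s + w (false :: s) <= u) :: s
  else [::].

Definition bit (u : R) (i : nat) : bool :=
  left_end (bits u i) + w (false :: bits u i) <= u.

Lemma history_bit u m : history (bit u) m = bits u m.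
Proof. by elim: m => //= m ->. Qed.

Lemma bits_itv u s : (0 <= u < 1 /\ history (bit u) (size s) = s) <->
  left_end s <= u < left_end s + w s.
Proof.
rewrite history_bit; elim: s => [|b s IH] /=; first by rewrite w_nil add0r; split=> [[]|].
have w0 := w_ge0 (false :: s); have w1 := w_ge0 (true :: s).
split=> [[u01 [<- sE]]|].
  have := (iffLR IH) (conj u01 sE); rewrite sE.
  have ws := w_split s; move=> /andP[h1 h2].
  by case: (leP (left_end s + w (false :: s)) u) => h /=; apply/andP; split; rewrite ?addr0//; lra.
move=> bu; have [u01 sE] : 0 <= u < 1 /\ bits u (size s) = s.
  apply/IH; rewrite w_split; case: b bu => /andP[h1 h2]; apply/andP; split; lra.
split=> //; rewrite sE; congr cons; case: b bu => /andP[h1 h2] //.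
by apply/negbTE; rewrite -ltNge; rewrite addr0 in h2.
Qed.

Lemma measurable_bits s : measurable [set u : measurableTypeR R |
  history (bit u) (size s) = s].
Proof.
elim: s => [|b s IH] /=.
  by rewrite (_ : [set _ | _] = setT)//; apply/seteqP; split => u.
rewrite (_ : [set _ | _] = [set u | history (bit u) (size s) = s] `&`
    [set u | (left_end s + w (false :: s) <= u) = b]); last first.
  apply/seteqP; split=> u /=; rewrite history_bit; first by move=> [<- sE]; rewrite /bit !sE.
  by move=> [sE <-]; rewrite /bit !sE.
apply: measurableI => //; case: b.
  rewrite (_ : [set _ | _] = `[left_end s + w (false :: s), +oo[%classic)//.
  by apply/seteqP; split=> u /=; rewrite in_itv/= andbT.
rewrite (_ : [set _ | _] = `]-oo, left_end s + w (false :: s)[%classic)//.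
apply/seteqP; split=> u /=; rewrite in_itv/= ltNge; first by move=> ->.
by move/negbTE.
Qed.

(* Lebesgue measure on the unit interval. *)
Let Q : probability (measurableTypeR R) R := uniform_prob (@ltr01 R).

Let Q_itv x y : 0 <= x -> x <= y -> y <= 1 -> prob Q `[x, y[ = y - x.
Proof.
move=> x0 xy y1.
transitivity (fine (\int[lebesgue_measure]_(u in `[x, y[)
  (uniform_pdf 0 1 u)%:E)%E); first by [].
rewrite (eq_integral (cst 1%E)); last first.
  move=> u /set_mem/=; rewrite in_itv/= => /andP[xu uy].
  by rewrite /uniform_pdf (le_trans x0 xu) (le_trans (ltW uy) y1) subr0 invr1.
rewrite integral_cst// mul1e.
rewrite [fine _](congr1 fine (lebesgue_measure_itv `[x, y[)).
rewrite /= lte_fin lt_neqAle xy andbT.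
by have [->|_] := eqVneq x y; rewrite /= ?subrr.
Qed.

Lemma prob_bits01 : prob Q `[0, 1[ = 1.
Proof. by rewrite Q_itv ?subr0. Qed.

Lemma left_end_bounds s : 0 <= left_end s /\ left_end s + w s <= 1.
Proof.
elim: s => [|b s [IH0 IH1]] /=; first by rewrite w_nil add0r.
have w0 := w_ge0 (false :: s); have w1 := w_ge0 (true :: s).
by move: IH1; rewrite w_split; case: b => IH1; split; lra.
Qed.

Lemma prob_bits s : prob Q [set u | history (bit u) (size s) = s] = w s.
Proof.
have [l0 l1] := left_end_bounds s.
have <- : prob Q `[left_end s, left_end s + w s[ = w s.
  by rewrite Q_itv ?lerDl// addrC addKr.
have mB := measurable_bits s.
have m01 : measurable (`[0, 1[%classic : set (measurableTypeR R)) by [].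
have null : prob Q (~` `[0, 1[) = 0.
  by rewrite -[~` _]setTI probIC// setTI probT prob_bits01 subrr.
rewrite (probDI Q mB m01) (_ : _ `&` `[0, 1[ = `[left_end s, left_end s + w s[%classic).
  rewrite (_ : prob Q (_ `&` _) = 0) ?add0r//; apply/le_anti/andP; split.
    have mC : measurable (~` (`[0, 1[%classic : set (measurableTypeR R))).
      exact: measurableC.
    apply: le_trans (_ : prob Q (~` `[0, 1[) <= 0); last by rewrite null.
    apply: le_prob => //; first exact: measurableI.

  exact: prob_ge0.
apply/seteqP; split=> u /=; rewrite !in_itv/=.
  by move=> [us u01]; apply/bits_itv.
by move/bits_itv => [].
Qed.

End random_bits.

(** * Weak convergence from open sets *)

Section weak_convergence.
Context {R : realType}.

(** The left-hand sum counts the positive integers below y. *)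
Lemma count_levels (N : nat) (y : R) : 0 <= y <= N%:R ->
  y - 1 <= \sum_(i < N) ((i.+1%:R < y)%R)%:R <= y.
Proof.
move=> /andP[y0 yN]; apply/andP; split.
  elim: N yN => [|N IH] yN; first by rewrite big_ord0; lra.
  rewrite big_ord_recr /=; have [/IH yN'|yN'] := leP y N%:R.
    by apply: (le_trans yN'); rewrite lerDl.
  rewrite (eq_bigr (fun=> 1)) => [|i _]; last first.
    by rewrite (le_lt_trans _ yN')// ler_nat.
  rewrite sumr_const card_ord; rewrite -natr1 in yN *.
  have : 0 <= ((N%:R + 1 < y)%R)%:R :> R by []. 
  lra.
have sumN M : \sum_(i < M) ((i.+1%:R < y)%R)%:R <= M%:R :> R.
  rewrite -[in leRHS](card_ord M) -sumr_const; apply: ler_sum => i _.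
  by rewrite lern1 leq_b1.
elim: N {yN} => [|N IH]; first by rewrite big_ord0.
rewrite big_ord_recr /=; have [lt|_] := ltP; last by rewrite addr0.
apply: le_trans (ltW lt); rewrite -natr1 lerD2r; exact: sumN.
Qed.

Context {d} {T : measurableType d}.

Lemma bounded_integrable (P : probability T R) (f : T -> R) (M : R) :
  measurable_fun setT f -> (forall x, `|f x| <= M) ->
  P.-integrable setT (EFin \o f).
Proof.
move=> mf fM; apply: measurable_bounded_integrable => //.
  by rewrite -ge0_fin_numE// fin_num_measure.
exists M; split; first exact: num_real.
by move=> x Mx y _; apply: le_trans (fM y) (ltW Mx).
Qed.

Lemma Rintegral_indic (P : probability T R) (A : set T) : measurable A ->
  (\int[P]_x \1_A x)%R = prob P A.
Proof. by move=> mA; rewrite /Rintegral integral_indic// setIT. Qed.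

Let measurable_superlevel (f : T -> R) (c : R) : measurable_fun setT f ->
  measurable [set x | c < f x].
Proof.
move=> mf; rewrite (_ : [set x | _] = f @^-1` `]c, +oo[).
  by rewrite -[X in measurable X]setTI; exact: mf.
by apply/seteqP; split=> x /=; rewrite in_itv/= andbT.
Qed.

(** Slicing the range [-M, M] of f into N levels approximates its integral by
probabilities of superlevel sets. *)
Lemma integral_levels (P : probability T R) (f : T -> R) (M e : R) (N : nat) :
  measurable_fun setT f -> (forall x, `|f x| <= M) -> 0 < M -> (0 < N)%N ->
  e = 2 * M / N%:R ->
  let S := \sum_(i < N) prob P [set x | - M + e * i.+1%:R < f x] in
  (- M + e * S <= \int[P]_x f x) /\ (\int[P]_x f x <= - M + e * S + e).
Proof.
move=> mf fM M0 N0 eE S.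
have N0' : 0 < N%:R :> R by rewrite ltr0n.
have e0 : 0 < e by rewrite eE divr_gt0// mulr_gt0.
pose E (i : nat) := [set x | - M + e * i.+1%:R < f x].
have mE i : measurable (E i) by exact: measurable_superlevel.
pose g n x : R := \sum_(i < n) \1_(E i) x.
have iE i : P.-integrable setT (EFin \o \1_(E i)).
  apply: (@bounded_integrable _ _ 1) => // x.
  by rewrite indicE ger0_norm// lern1 leq_b1.
have ig n : P.-integrable setT (EFin \o g n).
  apply: (@bounded_integrable _ _ n%:R).
    by apply: measurable_sum => i; exact: measurable_indic.
  move=> x; rewrite ger0_norm ?sumr_ge0//.
  rewrite -[in leRHS](card_ord n) -sumr_const; apply: ler_sum => i _.
  by rewrite indicE lern1 leq_b1.
have gE n : (\int[P]_x g n x)%R = \sum_(i < n) prob P (E i).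
  elim: n => [|n IH].
    rewrite big_ord0; transitivity (\int[P]_(x in setT) (0 : R)).
      by apply: eq_Rintegral => x _; rewrite /g big_ord0.
    by rewrite Rintegral_cst// mul0r.
  rewrite big_ord_recr /= -IH -Rintegral_indic// -RintegralD//.
  by apply: eq_Rintegral => x _; rewrite /g big_ord_recr.
have gf x : - M + e * g N x <= f x <= - M + e * g N x + e.
  have /andP[fl fr] : - M <= f x <= M by rewrite -ler_norml.
  have := @count_levels N ((f x + M) / e).
  rewrite (eq_bigr (fun i : 'I_N => \1_(E i) x)); last first.
    move=> i _; rewrite ltr_pdivlMr// indicE; congr (_ %:R); congr nat_of_bool.
    by apply/idP/idP; rewrite inE /E /= mulrC; lra.
  rewrite -/(g N x) => /(_ _)/wrap[|/andP[g1 g2]].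
    apply/andP; split; first by rewrite divr_ge0//; lra.
    rewrite ler_pdivrMr// eE mulrC divfK ?gt_eqF//; lra.
  move: g1 g2; rewrite lerBlDr ler_pdivrMr// ler_pdivlMr// => g1 g2.
  apply/andP; split; nra.
have ic c : P.-integrable setT (EFin \o (fun=> c)).
  exact: (@bounded_integrable _ (fun=> c) `|c|).
have ieg : P.-integrable setT (EFin \o (fun x => e * g N x)).
  exact: (integrableZl measurableT e (ig N)).
have il : P.-integrable setT (EFin \o (fun x => - M + e * g N x)).
  exact: (integrableD measurableT (ic (- M)) ieg).
have If := bounded_integrable P mf fM.
have lE : (\int[P]_x (- M + e * g N x))%R = - M + e * S.
  rewrite RintegralD// Rintegral_cst// RintegralZl// gE.
  by rewrite [fine _]probT mulr1.
rewrite -lE; split.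
  by apply: le_Rintegral => // x _; have /andP[] := gf x.
rewrite -[X in _ + X]mulr1 -(@probT _ _ _ P) -(Rintegral_cst P measurableT).
rewrite -RintegralD//; apply: le_Rintegral => //.
  exact: (integrableD measurableT il (ic e)).
by move=> x _; have /andP[] := gf x.
Qed.

End weak_convergence.

Section portmanteau.
Context {R : realType} (S : ptopologicalType).
Variables (nu : nat -> probability (borel S) R) (mu : probability (borel S) R).

Lemma open_borel (U : set S) : open U -> measurable (U : set (borel S)).
Proof. exact: sub_sigma_algebra. Qed.

Hypothesis liminf_open : forall (U : set S) (e : R), open U -> 0 < e ->
  \forall K \near \oo, prob mu U - e <= prob (nu K) U.

Let liminf_integral (f : S -> R) (M e : R) : continuous f ->
  (forall x, `|f x| <= M) -> 0 < e ->
  \forall K \near \oo, (\int[mu]_x f x)%R - e <= (\int[nu K]_x f x)%R.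
Proof.
move=> cf fM' e0; pose M1 := Num.max 1 M.
have M0 : 0 < M1 by rewrite lt_max ltr01.
have fM x : `|f x| <= M1 by rewrite le_max fM' orbT.
pose N := (Num.trunc (4 * M1 / e)).+1.
have N0 : 0 < N%:R :> R by rewrite ltr0n.
pose d := 2 * M1 / N%:R.
have d0 : 0 < d by rewrite divr_gt0// mulr_gt0.
have de : d <= e / 2.
  rewrite ler_pdivrMr//; have : 4 * M1 / e < N%:R by exact: truncnS_gt.
  rewrite ltr_pdivrMr//; nra.
have mf : measurable_fun setT (f : borel S -> R).
  exact: continuous_borel_measurable.
pose E (i : nat) : set S := [set x | - M1 + d * i.+1%:R < f x].
have oE i : open (E i).
  by apply: (@open_comp _ _ f [set y | _ < y]); [move=> x _; exact: cf|exact: open_gt].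
have e4 : 0 < e / (4 * M1) by rewrite divr_gt0// mulr_gt0.
have nearE : \forall K \near \oo, forall i : 'I_N,
    prob mu (E i) - e / (4 * M1) <= prob (nu K) (E i).
  by apply: filter_forall => i; exact: liminf_open.
near=> K.
have H : forall i : 'I_N,
    prob mu (E i) - e / (4 * M1) <= prob (nu K) (E i) by near: K.
have [_ mu2] := @integral_levels _ _ (borel S) mu f M1 d N mf fM M0 isT erefl.
have [nu1 _] := @integral_levels _ _ (borel S) (nu K) f M1 d N mf fM M0 isT erefl.
apply: le_trans nu1.
have : d * (\sum_(i < N) prob mu (E i)) - e / 2 <=
    d * (\sum_(i < N) prob (nu K) (E i)).
  have -> : e / 2 = d * \sum_(i < N) (e / (4 * M1)).
    by rewrite sumr_const card_ord -mulr_natl /d; field; rewrite !gt_eqF.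
  by rewrite -mulrBr ler_pM2l// -sumrB; exact: ler_sum.
lra.
Unshelve. all: by end_near. Qed.

(** The superlevel sets of a continuous function are open, so the hypothesis bounds
its integral by the lower limit of the integrals; the same bound for the opposite
function gives convergence. *)
Lemma converges_weakly_open : converges_weakly nu mu.
Proof.
move=> f cf [M fM].
have mf : measurable_fun setT (f : borel S -> R).
  exact: continuous_borel_measurable.
have iP (P : probability (borel S) R) : P.-integrable setT (EFin \o f).
  exact: (@bounded_integrable R _ (borel S) P f M mf fM).
have fE (P : probability (borel S) R) :
    (\int[P]_x (f x)%:E)%E = ((\int[P]_x f x)%R)%:E.
  by rewrite /Rintegral fineK//; exact: integrable_fin_num (iP P).
under eq_fun do rewrite fE.
rewrite fE; apply: cvg_EFin; first exact: nearW.
apply/cvgrPdist_le => e e0 /=.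
have cNf : continuous (fun x => - f x) by move=> x; apply: continuousN; exact: cf.
have fNM x : `|- f x| <= M by rewrite normrN.
have NE (P : probability (borel S) R) :
    (\int[P]_x (- f x))%R = - (\int[P]_x f x)%R.
  rewrite -mulN1r -(RintegralZl (-1) measurableT (iP P)).
  by apply: eq_Rintegral => x _; rewrite mulN1r.
have H1 := liminf_integral cf fM e0; have H2 := liminf_integral cNf fNM e0.
near=> K.
have l1 : (\int[mu]_x f x)%R - e <= (\int[nu K]_x f x)%R by near: K.
have : (\int[mu]_x (- f x))%R - e <= (\int[nu K]_x (- f x))%R by near: K.
rewrite !NE => l2.
by rewrite ler_norml; apply/andP; split; lra.
Unshelve. all: by end_near. Qed.

End portmanteau.

(** * Construction of the limit law *)

Lemma cvg_sum_seq (R : realType) (I : Type) (l : seq I) (V : pred I)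
    (f : I -> nat -> R) (a : I -> R) :
  (forall i, f i K @[K --> \oo] --> a i) ->
  \sum_(i <- l | V i) f i K @[K --> \oo] --> \sum_(i <- l | V i) a i.
Proof.
move=> fa; elim: l => [|i l IH].
  under eq_fun do rewrite big_nil.
  by rewrite big_nil; exact: cvg_cst.
under eq_fun do rewrite big_cons.
by rewrite big_cons; case: (V i) => //; apply: cvgD.
Qed.

Lemma set_eq_false (T : Type) (b : T -> bool) :
  [set x | b x = false] = ~` [set x | b x].
Proof.
by apply/seteqP; split=> x; [rewrite /setC /= => ->|move/negP/negbTE].
Qed.

Section limit_law.
Context {R : realType} {n : nat} (n_ge2 : (2 <= n)%N).
Variable nu : nat -> probability (borel (concave_fun R n)) R.

Local Notation passes := (passes n_ge2).
Local Notation test_point := (@test_point R n n_ge2).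
Local Notation tests_converge := (@tests_converge R n n_ge2).
Local Notation agrees := (@agrees R n n_ge2).

Hypothesis tests_cvg : forall J : seq nat,
  cvg (prob (nu K) [set psi | all (passes psi) J] @[K --> \oo]).
Hypothesis barycenter_bounded : forall e : R, 0 < e -> exists i,
  test_point i = barycenter n_ge2 /\
  \forall K \near \oo, prob (nu K) [set psi | passes psi i] <= e.
Hypothesis barycenter_positive : forall e : R, 0 < e -> exists i,
  [/\ test_point i = barycenter n_ge2, 0 < @test_level R n i &
  \forall K \near \oo, 1 - e <= prob (nu K) [set psi | passes psi i]].

Let measurable_passes i :
  measurable ([set psi | passes psi i] : set (borel (concave_fun R n))).
Proof.
apply: open_borel.
apply: (@open_comp _ _ (fun psi : concave_fun R n => psi (test_point i))
  [set x | _ < x]); last exact: open_gt.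
by move=> phi _; apply: continuous_concave_eval; exact: grid_open.
Qed.

Let measurable_all J :
  measurable ([set psi | all (passes psi) J] : set (borel (concave_fun R n))).
Proof.
elim: J => [|i J IH] /=.
  by rewrite (_ : [set _ | _] = setT)//; apply/seteqP; split.
rewrite (_ : [set _ | _] = [set psi | passes psi i] `&`
  [set psi | all (passes psi) J]); last first.
  by apply/seteqP; split=> psi /=; [move/andP|move=> [-> ->]].
exact: measurableI.
Qed.

Let cylinder s : set (borel (concave_fun R n)) :=
  [set psi | history (passes psi) (size s) = s].

Let cylinder_cons b s :
  cylinder (b :: s) = cylinder s `&` [set psi | passes psi (size s) = b].
Proof.
by apply/seteqP; split=> psi /= [e1 e2]; [split|rewrite /cylinder /= e1 e2].
Qed.

Let measurable_cylinder s : measurable (cylinder s).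
Proof.
elim: s => [|b s IH].
  by rewrite (_ : cylinder [::] = setT)//; apply/seteqP; split.
rewrite cylinder_cons; apply: measurableI => //; case: b; first exact: measurable_passes.
by rewrite set_eq_false; exact: measurableC.
Qed.

(** Inclusion-exclusion: a failed test is the difference of two events with fewer
failed tests. *)
Let is_cvg_cylinder s J : cvg (prob (nu K)
  ([set psi | all (passes psi) J] `&` cylinder s) @[K --> \oo]).
Proof.
elim: s J => [|b s IH] J.
  rewrite (_ : cylinder [::] = setT) ?setIT//; apply/seteqP; split=> //.
have consE : [set psi | all (passes psi) (size s :: J)] `&` cylinder s =
    [set psi | all (passes psi) J] `&` cylinder s `&`
    [set psi | passes psi (size s)].
  apply/seteqP; split=> psi /=; first by move=> [/andP[h1 h2] h3].
  by move=> [[h1 h2] h3]; split=> //; exact/andP.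
rewrite cylinder_cons setIA; case: b; first by rewrite -consE.
rewrite set_eq_false.
have -> : (fun K => prob (nu K) ([set psi | all (passes psi) J] `&`
    cylinder s `&` ~` [set psi | passes psi (size s)])) =
    (fun K => prob (nu K) ([set psi | all (passes psi) J] `&` cylinder s)) -
    (fun K => prob (nu K)
      ([set psi | all (passes psi) (size s :: J)] `&` cylinder s)).
  apply/funext => K; rewrite probIC ?consE//; exact: measurableI.
exact: is_cvgB.
Qed.

Let w s : R := lim (prob (nu K) (cylinder s) @[K --> \oo]).

Let cvg_w s : prob (nu K) (cylinder s) @[K --> \oo] --> w s.
Proof.
have := @is_cvg_cylinder s [::]; rewrite (_ : [set psi | _] = setT) ?setTI//.
by apply/seteqP; split.
Qed.

Let w_nil : w [::] = 1.
Proof.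
rewrite /w (_ : cylinder [::] = setT); last by apply/seteqP; split.
by under eq_fun do rewrite probT; exact: lim_cst.
Qed.

Let w_ge0 s : 0 <= w s.
Proof.
apply: limr_ge; first by apply/cvg_ex; exists (w s); exact: cvg_w.
by apply: nearW => K; exact: prob_ge0.
Qed.

Let w_split s : w s = w (false :: s) + w (true :: s).
Proof.
apply: cvg_lim => //.
have -> : (fun K => prob (nu K) (cylinder s)) =
    (fun K => prob (nu K) (cylinder (false :: s)) +
              prob (nu K) (cylinder (true :: s))).
  apply/funext => K; rewrite !cylinder_cons -probU.
  - congr prob; rewrite -setIUr -[LHS]setIT; congr setI.
    by apply/seteqP; split=> // psi _ /=; case: passes; [right|left].
  - by rewrite -cylinder_cons.
  - by rewrite -cylinder_cons.
  - by apply/seteqP; split=> // psi /= [[_ ->] []].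
by apply: cvgD; exact: cvg_w.
Qed.

Let Q : probability (measurableTypeR R) R := uniform_prob (@ltr01 R).

Local Notation bit := (bit w).

Let history_law m (V : pred (seq bool)) :
  measurable ([set u | V (history (bit u) m)] : set (measurableTypeR R)) /\
  prob (nu K) [set psi | V (history (passes psi) m)] @[K --> \oo] -->
    prob Q [set u | V (history (bit u) m)].
Proof.
have [mV ->] := prob_history Q m V (measurable_bits w).
split=> //; under eq_fun do
  rewrite (proj2 (prob_history (nu _) m V measurable_cylinder)).
apply: cvg_sum_seq => s.
by rewrite (prob_bits w_nil w_ge0 w_split); exact: cvg_w.
Qed.

Let bit_law i :
  measurable ([set u | bit u i] : set (measurableTypeR R)) /\
  prob (nu K) [set psi | passes psi i] @[K --> \oo] --> prob Q [set u | bit u i].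
Proof. exact: (history_law i.+1 (head false)). Qed.

Let agreesE b m : agrees b m = [set psi | history (passes psi) m = history b m].
Proof. by apply/seteqP; split=> psi /=; rewrite eq_history. Qed.

(** The history of u has positive weight, so it has positive probability under
some nu K. *)
Let agrees_bit_inhabited u m : 0 <= u < 1 -> agrees (bit u) m !=set0.
Proof.
move=> u01; apply/set0P/eqP => ag0.
have : left_end w (history (bit u) m) <= u <
    left_end w (history (bit u) m) + w (history (bit u) m).
  by apply/(bits_itv w_nil w_ge0 w_split); rewrite size_history.
suff -> : w (history (bit u) m) = 0 by rewrite addr0 => /andP[/le_lt_trans/[apply]]; rewrite ltxx.
apply: cvg_lim => //; rewrite (_ : (fun _ => _) = fun=> 0); first exact: cvg_cst.
by apply/funext => K; rewrite /cylinder size_history -agreesE ag0 /prob measure0.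
Qed.

Let good : set R := [set u | 0 <= u < 1 /\
  exists i, test_point i = barycenter n_ge2 /\ ~~ bit u i].

Let limit_of_bits u : good u -> exists psi, tests_converge (bit u) psi.
Proof.
move=> [u01 [i [ic bi]]]; apply: (tests_limit_exists _ ic bi) => m.
exact: agrees_bit_inhabited.
Qed.

(** The function determined by the bits of u; on the null set of bits that bound
nothing at the barycenter, an arbitrary function. *)
Let Phi (u : measurableTypeR R) : borel (concave_fun R n) :=
  if pselect (good u) is left gu then projT1 (cid (limit_of_bits gu)) else point.

Let Phi_converge u : good u -> tests_converge (bit u) (Phi u).
Proof. by move=> gu; rewrite /Phi; case: pselect => // gu'; case: cid. Qed.

Let measurable_good : measurable (good : set (measurableTypeR R)).
Proof.
rewrite (_ : good = `[0, 1[ `&` \bigcup_(i in [set i |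
    test_point i = barycenter n_ge2]) ~` [set u | bit u i]); last first.
  apply/seteqP; split=> u /=; rewrite in_itv/=.
    by move=> [u01 [i [ic /negP bi]]]; split=> //; exists i.
  by move=> [u01 [i ic /negP bi]]; split=> //; exists i.
apply: measurableI => //; apply: bigcup_measurable => i _.
by apply: measurableC; exact: (bit_law i).1.
Qed.

Let prob_good : prob Q good = 1.
Proof.
apply/le_anti/andP; split; first exact: prob_le1.
apply/ler_addgt0Pr => e e0; rewrite -lerBlDr.
have [i [ic iK]] := barycenter_bounded e0.
have [mi ci] := bit_law i.
have m01 : measurable (`[0, 1[%classic : set (measurableTypeR R)) by [].
have bie : prob Q [set u | bit u i] <= e.
  rewrite -(cvg_lim _ ci)//; apply: limr_le iK.
  by apply/cvg_ex; exists (prob Q [set u | bit u i]).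
apply: (@le_trans _ _ (prob Q (`[0, 1[ `&` ~` [set u | bit u i]))).
  rewrite probIC// prob_bits01 lerD2l lerN2; apply: le_trans bie.
  by apply: le_prob => //; exact: measurableI.
apply: le_prob => //; first by apply: measurableI => //; exact: measurableC.
move=> u [] /=; rewrite in_itv/= => u01 /negP bi.
by split=> //; exists i.
Qed.

Let probI_good A : measurable A -> prob Q (good `&` A) = prob Q A.
Proof.
move=> mA; rewrite setIC [RHS](probDI Q mA measurable_good).
rewrite (_ : prob Q (A `&` ~` good) = 0) ?add0r//.
apply/le_anti/andP; split; last exact: prob_ge0.
apply: (@le_trans _ _ (prob Q (~` good))).
  have mC : measurable (~` good) by exact: measurableC.
  by apply: le_prob => //; exact: measurableI.
by rewrite -[~` _]setTI probIC// setTI probT prob_good subrr.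
Qed.

Let measurable_Phi : measurable_fun setT Phi.
Proof.
have := @measurable_concave_fun R n n_ge2 _ (measurableTypeR R) Phi.
apply => v.
apply: (measurability _ (RGenOInfty.measurableE R)).
move=> _ [_ [t ->] <-]; rewrite setTI.
pose p : simplex R n := grid n_ge2 v.
rewrite (_ : _ @^-1` _ = (good `&` \bigcup_(i in [set i | test_point i = p /\
    t < @test_level R n i]) [set u | bit u i]) `|`
    (~` good `&` [set u | t < (point : concave_fun R n) p])); last first.
  apply/seteqP; split=> u /=; rewrite in_itv/= andbT.
    have [gu|ngu] := pselect (good u); last first.
      by move=> H; right; split=> //; move: H; rewrite /Phi; case: pselect.
    move=> tu; left; split=> //.
    have [x] := rat_in_itvoo tu; rewrite in_itv/= => /andP[tx xP].
    have [i [iv ix]] := @test_surj R n n_ge2 v x.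
    exists i; first by rewrite /= ix.
    have := @tests_converge_level R n n_ge2 (bit u) (Phi u) i
      (fun m => @agrees_bit_inhabited u m gu.1) (Phi_converge gu).
    by rewrite iv ix /=; case: (bit u i) => //; rewrite leNgt xP.
  move=> [[gu [i [iv it] bi]]|[ngu tp]].
    have := @tests_converge_level R n n_ge2 (bit u) (Phi u) i
      (fun m => @agrees_bit_inhabited u m gu.1) (Phi_converge gu).
    by rewrite bi iv; exact: lt_le_trans.
  by rewrite /Phi; case: pselect.
apply: measurableU.
  apply: measurableI => //; apply: bigcup_measurable => i _.
  exact: (bit_law i).1.
apply: measurableI; first exact: measurableC.
by case: (t < _); [rewrite (_ : [set _ | _] = setT)|rewrite (_ : [set _ | _] = set0)];
  rewrite //; apply/seteqP; split.
Qed.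

HB.instance Definition _ := isMeasurableFun.Build _ _ _ _ Phi measurable_Phi.

Let mu := distribution Q Phi.

Let prob_mu A : prob mu A = prob Q (Phi @^-1` A).
Proof. by []. Qed.

(** If Phi u lies in the open set U, then so do all functions that give the same
answers as u to finitely many tests; under nu K those answers have nearly the
probability that they have for random bits. *)
Let mu_liminf (U : set (concave_fun R n)) (e : R) : open U -> 0 < e ->
  \forall K \near \oo, prob mu U - e <= prob (nu K) U.
Proof.
move=> oU e0.
pose V (s : seq bool) : bool := `[< cylinder s `<=` U >].
pose E m : set (measurableTypeR R) := [set u | V (history (bit u) m)].
have mE m : measurable (E m) by exact: (history_law m V).1.
have ndE : nondecreasing_seq E.
  move=> m k mk; apply/subsetPset => u; rewrite /E /V /= /cylinder !size_history.
  rewrite -!agreesE => /asboolP H; apply/asboolP.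
  exact: subset_trans (agrees_decr mk) H.
have mUE : measurable (\bigcup_m E m) by exact: bigcup_measurable.
have PhiE : good `&` Phi @^-1` U `<=` \bigcup_m E m.
  move=> u [gu Uu]; have [|m mU] := Phi_converge gu (U := U).
    exact: open_nbhs_nbhs.
  by exists m => //; apply/asboolP; rewrite /cylinder size_history -agreesE.
have mPU : measurable (Phi @^-1` U).
  by rewrite -[X in measurable X]setTI; apply: measurable_Phi => //; exact: open_borel.
have muUE : prob mu U <= prob Q (\bigcup_m E m).
  by rewrite prob_mu -probI_good//; apply: le_prob => //; exact: measurableI.
have cE : prob Q (E m) @[m --> \oo] --> prob Q (\bigcup_m E m).
  apply: fine_cvg; rewrite -probE//.
  exact: nondecreasing_cvg_mu.
have e2 : 0 < e / 2 by rewrite divr_gt0.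
have [m mP] : exists m, prob Q (\bigcup_m E m) - e / 2 < prob Q (E m).
  have lt : prob Q (\bigcup_m E m) - e / 2 < prob Q (\bigcup_m E m).
    by rewrite gtrBl.
  by have [m _ H] := cvgr_gt _ cE _ lt; exists m; apply: H => /=.
have lt : prob Q (E m) - e / 2 < prob Q (E m) by rewrite gtrBl.
have near_nu := cvgr_gt _ (history_law m V).2 _ lt.
near=> K.
have : prob Q (E m) - e / 2 < prob (nu K) [set psi | V (history (passes psi) m)].
  by near: K; exact: near_nu.
have : prob (nu K) [set psi | V (history (passes psi) m)] <= prob (nu K) U.
  apply: le_prob; [|exact: open_borel|].
    exact: (prob_history (nu K) m V measurable_cylinder).1.
  by move=> psi /= /asboolP; apply; rewrite /cylinder /= size_history.
lra.
Unshelve. all: by end_near. Qed.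

(** The convergence of the probabilities of finitely many passed tests suffices,
with control at the barycenter: boundedness lets the limiting bits determine a
function, and positivity makes that function positive. *)
Lemma limit_law_exists : exists mu : probability (borel (concave_fun R n)) R,
  mu (@concave_pos R n) = 1%E /\ converges_weakly nu mu.
Proof.
exists mu; split; last exact: converges_weakly_open mu_liminf.
(* By [concave_scale] positivity at the barycenter is positivity inside. *)
have posE : @concave_pos R n = [set psi | 0 < psi (barycenter n_ge2)].
  apply/seteqP; split=> psi /=; first by apply; exact: barycenter_open.
  move=> psi0 p op.
  have cA : @inner_compact R n [set p].
    by split; [exact: compact_set1|move=> _ ->].
  have [a a0 /(_ p erefl) pa] := inner_compact_coord_ge cA.
  have a10 : 0 < Num.min a 1 by rewrite lt_min a0 ltr01.
  have a11 : Num.min a 1 <= 1 by rewrite ge_min lexx orbT.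
  have := @concave_fun_scale R n n_ge2 psi p (barycenter n_ge2) (1 - Num.min a 1).
  rewrite subKr subr_ge0 a11 gerBl ltW// => /(_ isT) H.
  apply: lt_le_trans (H _); first by rewrite mulr_gt0.
  move=> i; apply: le_trans (pa i); apply: (@le_trans _ _ (Num.min a 1)).
    rewrite ger_pMr//.
    by have /andP[_ ->] := simplex_coord_itv (barycenter n_ge2 : simplex R n) i.
  by rewrite ge_min lexx.
have mpos : measurable (@concave_pos R n : set (borel (concave_fun R n))).
  apply: open_borel; rewrite posE.
  apply: (@open_comp _ _ (fun psi : concave_fun R n => psi (barycenter n_ge2))
    [set x | 0 < x]); last exact: open_gt.
  by move=> phi _; apply: continuous_concave_eval; exact: barycenter_open.
rewrite probE//; congr EFin; apply/le_anti/andP; split; first exact: prob_le1.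
apply/ler_addgt0Pr => e e0; rewrite -lerBlDr.
have [i [ic i0 iK]] := barycenter_positive e0.
have [mi ci] := bit_law i.
have : 1 - e <= prob Q [set u | bit u i].
  rewrite -(cvg_lim _ ci)//; apply: limr_ge iK.
  by apply/cvg_ex; exists (prob Q [set u | bit u i]).
move=> /le_trans; apply; rewrite -probI_good// prob_mu.
apply: le_prob; first exact: measurableI.
  by rewrite -[X in measurable X]setTI; exact: measurable_Phi.
move=> u [gu bi]; rewrite /= posE.
have := @tests_converge_level R n n_ge2 (bit u) (Phi u) i
  (fun m => @agrees_bit_inhabited u m gu.1) (Phi_converge gu).
by rewrite bi ic; exact: lt_le_trans.
Qed.

End limit_law.

(** * Homogeneous measures on the orthant *)

Section image_measure.
Context d d' (T1 : measurableType d) (T2 : measurableType d') (R : realType).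
Variables (m : {measure set T1 -> \bar R}) (f : T1 -> T2).

(** The pushforward, packed with its measurability proof as an argument so that
the measure structure can be inferred. *)
Definition image_measure (mf : measurable_fun setT f) :
    {measure set T2 -> \bar R} :=
  measure_function_pushforward__canonical__measure_function_Measure m mf.

End image_measure.

Section lebesgue_scaling.
Context {R : realType}.
Implicit Types s : R.

Lemma measurable_mulr s :
  measurable_fun setT (fun x : measurableTypeR R => s * x : measurableTypeR R).
Proof. exact: mulrl_measurable. Qed.

Lemma lebesgue_measure_scale s (A : set (measurableTypeR R)) : 0 < s ->
  measurable A ->
  lebesgue_measure A = (s%:E * lebesgue_measure ((fun x => (s * x)%R) @^-1` A))%E.
Proof.
move=> s0 mA.
pose mu' : {measure set (measurableTypeR R) -> \bar R} :=
  mscale (NngNum (ltW s0)) (image_measure (@lebesgue_measure R) (measurable_mulr s)).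
rewrite (@lebesgue_measure_unique _ mu')// => _ [[a b] _ <-].
pose J : set (measurableTypeR R) := `]a / s, b / s]%classic.
rewrite [RHS](_ : _ = (s%:E * lebesgue_measure J)%E); last first.
  rewrite /= /mscale /=; congr (_ * _)%E; congr (lebesgue_measure _).
  apply/seteqP; split=> x; rewrite /J /= !in_itv/=.
    by rewrite ltr_pdivrMr// ler_pdivlMr// mulrC.
  by rewrite ltr_pdivrMr// ler_pdivlMr// mulrC.
rewrite /J !lebesgue_measure_itv/= !lte_fin.
rewrite ltr_pM2r ?invr_gt0//; case: ifP => _; last by rewrite mule0.
by rewrite -!EFinB -EFinM -mulrBl mulrCA divff ?gt_eqF// mulr1.
Qed.

Definition scale n s (x : borel 'rV[R]_n) : borel 'rV[R]_n := s *: (x : 'rV[R]_n).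

Lemma measurable_scale n s : measurable_fun setT (@scale n s).
Proof.
apply: measurable_rV => i.
rewrite (_ : (fun _ => _) = fun x : borel 'rV[R]_n => s * (x : 'rV[R]_n) 0 i); last first.
  by apply/funext => x; rewrite /scale mxE.
apply: measurable_funM => //; exact: measurable_coord.
Qed.

Lemma measurable_preimage_scale n s (A : set (borel 'rV[R]_n)) : measurable A ->
  measurable (scale s @^-1` A).
Proof.
by move=> mA; rewrite -[X in measurable X]setTI; exact: measurable_scale.
Qed.

(** By induction on the dimension: both sides are measures on a product, and they
agree on rectangles. *)
Lemma lebesgue_rV_scale n s (A : set (borel 'rV[R]_n)) : 0 < s -> measurable A ->
  lebesgue_rV R n A = ((s ^+ n)%:E * lebesgue_rV R n (scale s @^-1` A))%E.
Proof.
move=> s0; elim: n A => [|n IH] A mA.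
  rewrite expr0 mul1e /= /dirac/= !indicE; congr (_ %:R%:E); congr nat_of_bool.
  by apply/idP/idP; rewrite !inE /= /scale scaler0.
pose f (xv : measurableTypeR R * borel 'rV[R]_n) :=
  ((s * xv.1 : measurableTypeR R), scale s xv.2).
have mf : measurable_fun setT f.
  apply/measurable_fun_pairP; split.
    by apply: measurable_funM => //; exact: measurable_fst.
  by apply: (measurableT_comp (@measurable_scale n s)); exact: measurable_snd.
have sn0 : 0 <= s ^+ n.+1 by rewrite exprn_ge0// ltW.
pose mu' : {measure set (measurableTypeR R * borel 'rV[R]_n) -> \bar R} :=
  mscale (NngNum sn0)
    (image_measure (@lebesgue_measure R \x lebesgue_rV R n)%E mf).
have mA' : measurable (@row_cons R n @^-1` A).
  by rewrite -[X in measurable X]setTI; exact: measurable_row_cons.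
rewrite [LHS](@product_measure_unique _ _ _ _ _ _ _ mu')//; last first.
  move=> B D mB mD.
  rewrite [LHS](_ : _ = ((s ^+ n.+1)%:E * ((@lebesgue_measure R \x lebesgue_rV R n)
      (((fun x => s * x)%R @^-1` B) `*` (scale s @^-1` D))))%E)//.
  rewrite product_measure1E//; last 2 first.
  - by rewrite -[X in measurable X]setTI; exact: measurable_mulr.
  - exact: measurable_preimage_scale.
  have e1 := lebesgue_measure_scale s0 mB; have e2 := IH D mD.
  apply: etrans (congr2 mule (esym e1) (esym e2)).
  by rewrite exprS EFinM -!muleA; congr (_ * _)%E; rewrite muleCA.
rewrite [LHS]/= /mscale /=; congr (_ * _)%E.
rewrite /lebesgue_succ /pushforward; congr (product_measure1 _ _ _).
have fE x v : row_cons (f (x, v)) = scale s (row_cons (x, v)).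
  have := scale_row_mx s (x%:M : 'M[R]_1) (v : 'rV[R]_n).
  by rewrite scale_scalar_mx => /esym.
by apply/seteqP; split=> -[x v] /=; rewrite fE.
Qed.

End lebesgue_scaling.

Section density_measure.
Context d (T : measurableType d) (R : realType).
Variables (m : {measure set T -> \bar R}) (g : T -> R).

(** The proofs are arguments, so that the measure structure can be inferred. *)
Definition density_measure of measurable_fun setT g & (forall x, 0 <= g x) :=
  fun A : set T => (\int[m]_(x in A) (g x)%:E)%E.

Hypotheses (mg : measurable_fun setT g) (g0 : forall x, 0 <= g x).

Let density0 : density_measure mg g0 set0 = 0%E.
Proof. exact: integral_set0. Qed.

Let density_ge0 A : (0 <= density_measure mg g0 A)%E.
Proof. by apply: integral_ge0 => x _; rewrite lee_fin. Qed.

Let density_sigma_additive : semi_sigma_additive (density_measure mg g0).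
Proof.
move=> /= F mF tF mUF; rewrite /density_measure; apply: cvg_toP.
  apply: ereal_nondecreasing_is_cvgn => i j ij.
  apply: lee_sum_nneg_natr => // k _ _.
  by apply: integral_ge0 => x _; rewrite lee_fin.
rewrite ge0_integral_bigcup//=.
- by apply: measurable_funTS; exact/measurable_EFinP.
- by move=> x _; rewrite lee_fin.
Qed.

HB.instance Definition _ := isMeasure.Build _ _ _ (density_measure mg g0)
  density0 density_ge0 density_sigma_additive.

End density_measure.

Section homogeneous_measures.
Context {R : realType} {n : nat}.
Implicit Types (x : 'rV[R]_n) (r s : R) (A B U : set (borel 'rV[R]_n)).

(** On the orthant this is the l1 norm. *)
Definition coord_sum x : R := \sum_(i < n) x 0 i.

Lemma coord_sum_scale s x : coord_sum (s *: x) = s * coord_sum x.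
Proof. by rewrite /coord_sum mulr_sumr; apply: eq_bigr => i _; rewrite mxE. Qed.

Lemma measurable_coord_sum :
  measurable_fun setT (fun x : borel 'rV[R]_n => coord_sum x).
Proof. by apply: measurable_sum => i; exact: measurable_coord. Qed.

Definition Rplus : set (borel 'rV[R]_n) := @orthant_set R n.

Lemma measurable_Rplus : measurable Rplus.
Proof.
rewrite (_ : Rplus = \bigcap_(i in [set: 'I_n]) [set x | 0 < (x : 'rV[R]_n) 0 i]).
  apply: fin_bigcap_measurable => // i _.
  rewrite (_ : [set _ | _] = (fun x : borel 'rV[R]_n => x 0 i) @^-1` `]0, +oo[).
    by rewrite -[X in measurable X]setTI; exact: measurable_coord.
  by apply/seteqP; split=> x /=; rewrite in_itv/= andbT.
by apply/seteqP; split=> x //= H i; [move=> _; exact: H|exact: (H i)].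
Qed.

Lemma Rplus_scale s x : 0 < s -> Rplus (s *: x) <-> Rplus x.
Proof.
move=> s0; split=> H i; have := H i; rewrite mxE; first by rewrite pmulr_rgt0.
by move=> ?; rewrite mulr_gt0.
Qed.

Lemma coord_sum_ge0 x : Rplus x -> 0 <= coord_sum x.
Proof. by move=> x0; apply: sumr_ge0 => i _; exact/ltW/x0. Qed.

Lemma coord_sum_gt0 x : (0 < n)%N -> Rplus x -> 0 < coord_sum x.
Proof.
move=> n0 x0; rewrite /coord_sum (bigD1 (Ordinal n0))//= ltr_pwDl//.
by apply: sumr_ge0 => i _; exact/ltW/x0.
Qed.

Definition cap r : set (borel 'rV[R]_n) := [set x | Rplus x /\ coord_sum x <= r].

Definition shell r s : set (borel 'rV[R]_n) :=
  [set x | Rplus x /\ r < coord_sum x <= s].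

Let measurable_sub (J : interval R) :
  measurable [set x : borel 'rV[R]_n | Rplus x /\ coord_sum x \in J].
Proof.
rewrite (_ : [set _ | _] = Rplus `&` (fun x => coord_sum x) @^-1` [set` J])//.
apply: measurableI; first exact: measurable_Rplus.
by rewrite -[X in measurable X]setTI; exact: measurable_coord_sum.
Qed.

Lemma measurable_cap r : measurable (cap r).
Proof. exact: (measurable_sub `]-oo, r]). Qed.

Lemma measurable_shell r s : measurable (shell r s).
Proof. exact: (measurable_sub `]r, s]). Qed.

Lemma cap_scale r s : 0 < s -> scale s @^-1` cap r = cap (r / s).
Proof.
move=> s0; apply/seteqP; split=> x /=; rewrite /cap /scale /= coord_sum_scale.
  by move=> [/(Rplus_scale _ s0) ? ?]; rewrite ler_pdivlMr// mulrC.
by move=> [? ?]; split; [exact/Rplus_scale|rewrite mulrC -ler_pdivlMr].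
Qed.

Lemma shell_scale r t s : 0 < s ->
  scale s @^-1` shell r t = shell (r / s) (t / s).
Proof.
move=> s0; apply/seteqP; split=> x /=; rewrite /shell /scale /= coord_sum_scale.
  move=> [/(Rplus_scale _ s0) ? ?]; split=> //.
  by rewrite ltr_pdivrMr// ler_pdivlMr// mulrC.
move=> [? ?]; split; first exact/Rplus_scale.
by rewrite mulrC -ltr_pdivrMr// -ler_pdivlMr.
Qed.

Definition homogeneous_measure (b : R)
    (mu : {measure set (borel 'rV[R]_n) -> \bar R}) := forall s A, 0 < s ->
  measurable A -> mu A = ((s `^ b)%:E * mu (scale s @^-1` A))%E.

(** The volume element contributes the degree n, and the density its own degree. *)
Lemma density_homogeneous (g : borel 'rV[R]_n -> R) (a : R)
    (mg : measurable_fun setT g) (g0 : forall x, 0 <= g x) :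
  (forall s x, 0 < s -> g (scale s x) = s `^ a * g x) ->
  homogeneous_measure (n%:R + a) (density_measure (lebesgue_rV R n) mg g0).
Proof.
move=> gs s A s0 mA.
have sn0 : 0 <= s ^+ n by rewrite exprn_ge0// ltW.
have mEg B : measurable_fun B (fun x => (g x)%:E).
  by apply: measurable_funTS; exact/measurable_EFinP.
pose la := image_measure (lebesgue_rV R n) (@measurable_scale R n s).
rewrite [LHS](_ : _ = (\int[mscale (NngNum sn0) la]_(x in A) (g x)%:E)%E); last first.
  by apply: eq_measure_integral => B mB _; rewrite [LHS](lebesgue_rV_scale s0 mB).
rewrite ge0_integral_mscale//; last by move=> x _; rewrite lee_fin.
rewrite powRD; last by rewrite (gt_eqF s0) implybT.
rewrite powR_mulrn ?ltW// EFinM -muleA; congr (_ * _)%E.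
rewrite [LHS](ge0_integral_pushforward (@measurable_scale R n s))//; last first.
  by move=> x _; rewrite lee_fin.
rewrite -[RHS]ge0_integralZl//; last 3 first.
- exact: measurable_preimage_scale.
- by move=> x _; rewrite lee_fin.
- by rewrite lee_fin powR_ge0.
by apply: eq_integral => x _ /=; rewrite gs// EFinM.
Qed.

End homogeneous_measures.

Section homogeneous_mass.
Context {R : realType} {n : nat} (n_gt0 : (0 < n)%N).
Variables (b : R) (mu : {measure set (borel 'rV[R]_n) -> \bar R}).
Hypothesis mu_hom : homogeneous_measure b mu.
Implicit Types (r s : R) (k : nat).

Local Notation half := (2^-1 : R).
Local Notation shell := (@shell R n).
Local Notation cap := (@cap R n).

Let half_gt0 : 0 < half. Proof. by rewrite invr_gt0. Qed.

Let half_lt1 : half < 1. Proof. by rewrite invf_lt1// ltr1n. Qed.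

Let half_exp k : 0 < half ^+ k. Proof. by rewrite exprn_gt0. Qed.

Let shellU r s t : shell r t `<=` shell s t `|` shell r s.
Proof.
move=> x [x0 /andP[rx xt]]; have [xs|sx] := leP (coord_sum x) s.
  by right; split=> //; rewrite rx.
by left; split=> //; rewrite sx.
Qed.

Let mu_shellU r s t : (mu (shell r t) <= mu (shell s t) + mu (shell r s))%E.
Proof.
apply: (le_trans _ (measureU2 mu (measurable_shell s t) (measurable_shell r s))).
apply: le_measure; rewrite ?inE; [exact: measurable_shell| |exact: shellU].
by apply: measurableU; exact: measurable_shell.
Qed.

Let mu_shell r t s : 0 < s ->
  mu (shell r t) = ((s `^ b)%:E * mu (shell (r / s) (t / s)))%E.
Proof.
by move=> s0; rewrite (mu_hom s0 (measurable_shell r t)) shell_scale.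
Qed.

Let shell_trunc_nd r : 0 <= r ->
  nondecreasing_seq (fun k => shell (half ^+ k) r : set (borel 'rV[R]_n)).
Proof.
move=> r0 k m km; apply/subsetPset => x [x0 /andP[kx xr]]; split=> //.
rewrite xr andbT; apply: le_lt_trans kx.
by rewrite ler_wiXn2l// ltW.
Qed.

Let exp_half_lt r : 0 < r -> exists k, half ^+ k < r.
Proof.
move=> r0; have : half ^+ k @[k --> \oo] --> 0.
  by apply: cvg_expr; rewrite ger0_norm// ltW.
by move=> /cvgr_lt/(_ _ r0)[k _ kP]; exists k; apply: kP => /=.
Qed.

(** The dyadic shells, which are all multiples of one shell, cover the orthant. *)
Lemma Rplus_null : mu (shell half 1) = 0%E -> mu (@Rplus R n) = 0%E.
Proof.
move=> sh0.
have null s k : 0 < s -> mu (shell (s * half ^+ k) s) = 0%E.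
  move=> s0; elim: k => [|k IH].
    rewrite (_ : shell _ _ = set0) ?measure0//; apply/seteqP; split=> // x.
    by rewrite expr0 mulr1 => -[_ /andP[/lt_le_trans/[apply]]]; rewrite ltxx.
  apply/eqP; rewrite eq_le measure_ge0 andbT.
  apply: le_trans (mu_shellU _ (s * half ^+ k) _) _; rewrite IH add0e.
  rewrite (mu_shell _ _ (mulr_gt0 s0 (half_exp k))).
  by rewrite exprSr mulrA mulrAC divff ?mul1r ?sh0 ?mule0// gt_eqF// mulr_gt0.
pose F k : set (borel 'rV[R]_n) := shell (half ^+ k) (2 ^+ k).
have F0 k : mu (F k) = 0%E.
  have := null (2 ^+ k) (k + k)%N; rewrite exprD mulrA -exprMn mulfV//.
  by rewrite expr1n mul1r; apply; rewrite exprn_gt0.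
have FE : \bigcup_k F k = @Rplus R n.
  apply/seteqP; split=> [x [k _ []]//|x x0].
  have Nx := coord_sum_gt0 n_gt0 x0.
  have [k1 k1P] := exp_half_lt Nx.
  have /exp_half_lt[k2 k2P] : 0 < (coord_sum x)^-1 by rewrite invr_gt0.
  exists (maxn k1 k2) => //; split=> //; apply/andP; split.
    apply: le_lt_trans k1P; apply: ler_wiXn2l; rewrite ?ltW//.
    exact: leq_maxl.
  rewrite -lef_pV2 ?posrE ?exprn_gt0// -exprVn.
  apply: le_trans (ltW k2P); apply: ler_wiXn2l; rewrite ?ltW//.
  exact: leq_maxr.
apply/eqP; rewrite eq_le measure_ge0 andbT -FE.
have mF k : measurable (F k) by exact: measurable_shell.
have mUF : measurable (\bigcup_k F k) by exact: bigcup_measurable.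
apply: le_trans (measure_sigma_subadditive mu mF mUF (@subset_refl _ _)) _.
by rewrite eseries0.
Qed.

(** Summing the dyadic shells below 1 gives a geometric series of ratio
2 ^ (- b) < 1. *)
Lemma cap_lty : 0 < b -> (mu (shell half 1) < +oo)%E -> (mu (cap 1) < +oo)%E.
Proof.
move=> b0 fin.
have m_fin : mu (shell half 1) \is a fin_num by rewrite ge0_fin_numE.
pose m := fine (mu (shell half 1)).
have mE : mu (shell half 1) = m%:E by rewrite fineK.
pose q := half `^ b.
have q1 : q < 1.
  have := gt0_ltr_powR b0 _ _ half_lt1; rewrite powR1; apply; rewrite nnegrE// ltW.
have q0 : 0 <= q by exact: powR_ge0.
have m0 : 0 <= m by exact: fine_ge0.
(* Removing the outermost shell leaves half of a previous set, so the masses obey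
   x <= m + q x. *)
have bound k : (mu (shell (half ^+ k) 1) <= (m / (1 - q))%:E)%E.
  elim: k => [|k IH].
    rewrite (_ : shell _ _ = set0); last first.
      apply/seteqP; split=> // x.
      by rewrite expr0 => -[_ /andP[/lt_le_trans/[apply]]]; rewrite ltxx.
    by rewrite measure0 lee_fin divr_ge0// subr_ge0 ltW.
  apply: le_trans (mu_shellU _ half _) _.
  rewrite mE (mu_shell _ _ half_gt0) exprSr mulfK ?divff ?gt_eqF//.
  apply: (@le_trans _ _ (m%:E + q%:E * (m / (1 - q))%:E)%E).
    by rewrite leeD2l// lee_wpmul2l// lee_fin.
  rewrite -EFinM -EFinD lee_fin le_eqVlt; apply/orP; left; apply/eqP.
  by field; rewrite gt_eqF// subr_gt0.
have capE : \bigcup_k shell (half ^+ k) 1 = cap 1 :> set (borel 'rV[R]_n).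
  apply/seteqP; split=> [x [k _ [x0 /andP[_ x1]]]//|x [x0 x1]].
  have [k kP] := exp_half_lt (coord_sum_gt0 n_gt0 x0).
  by exists k => //; split=> //; rewrite kP.
apply: (@le_lt_trans _ _ (m / (1 - q))%:E); last exact: ltry.
rewrite -capE.
have mS k : measurable (shell (half ^+ k) 1) by exact: measurable_shell.
have mU : measurable (\bigcup_k shell (half ^+ k) 1) by exact: bigcup_measurable.
apply: (cvge_to_le (nondecreasing_cvg_mu (mu := mu) mS mU _)).
  exact: shell_trunc_nd.
by apply: nearW => k; exact: bound.
Qed.

Lemma mu_cap r : 0 < r -> mu (cap r) = ((r `^ b)%:E * mu (cap 1))%E.
Proof.
move=> r0; rewrite (mu_hom r0 (measurable_cap r)) cap_scale// divff//.
by rewrite gt_eqF.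
Qed.

End homogeneous_mass.

Section cube_volume.
Variable R : realType.

Definition unit_cube n : set (borel 'rV[R]_n) :=
  [set x | forall i, 0 <= (x : 'rV[R]_n) 0 i <= 1].
Arguments unit_cube : clear implicits.

Lemma measurable_unit_cube n : measurable (unit_cube n).
Proof.
rewrite (_ : unit_cube n = \bigcap_(i in [set: 'I_n])
    (fun x : borel 'rV[R]_n => (x : 'rV[R]_n) 0 i) @^-1` `[0, 1]%classic).
  apply: fin_bigcap_measurable => // i _.
  by rewrite -[X in measurable X]setTI; exact: measurable_coord.
apply/seteqP; split=> x /= H i; first by move=> _; rewrite /= in_itv; exact: H.
by have := H i Logic.I; rewrite /= in_itv.
Qed.

Lemma lebesgue_unit_cube_lty n : (lebesgue_rV R n (unit_cube n) < +oo)%E.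
Proof.
elim: n => [|n IH].
  apply: (@le_lt_trans _ _ 1%E); last exact: ltry.
  by rewrite /= /dirac/= lee_fin indicE; case: (_ \in _).
pose J : set (measurableTypeR R) := `[0, 1]%classic.
apply: (@le_lt_trans _ _ ((@lebesgue_measure R \x lebesgue_rV R n) (J `*` unit_cube n))%E).
  rewrite /= /lebesgue_succ /pushforward.
  apply: le_measure; rewrite ?inE.
  - rewrite -[X in measurable X]setTI; have := @measurable_row_cons R n.
    by move=> /(_ measurableT _ (@measurable_unit_cube n.+1)).
  - by apply: measurableX; [exact: measurable_itv|exact: (@measurable_unit_cube n)].
  - move=> [x v] H.
    have xE : (row_cons (x, v) : 'rV[R]_(1 + n)) 0 (lshift n ord0) = x.
      by rewrite /row_cons row_mxEl mxE mulr1n.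
    have vE i : (row_cons (x, v) : 'rV[R]_(1 + n)) 0 (rshift 1 i) =
        (v : 'rV[R]_n) 0 i by rewrite /row_cons row_mxEr.
    split=> [|i] /=; first by rewrite /J /= in_itv/= -xE; exact: H.
    by rewrite -vE; exact: H.
have mJ : measurable J by exact: measurable_itv.
rewrite [ltLHS](product_measure1E (@lebesgue_measure R) (lebesgue_rV R n) mJ (@measurable_unit_cube n)).
have JE : lebesgue_measure J = 1%E.
  by rewrite /J lebesgue_measure_itv/= lte_fin ltr01 -EFinB subr0.
by rewrite lte_mul_pinfty// [X in X \is a fin_num]JE.
Qed.

End cube_volume.

(** * The tail of the density near the origin *)

Lemma powRN_mul (R : realType) (s a : R) : 0 < s -> s `^ a * s `^ (- a) = 1.
Proof.
by move=> s0; rewrite -powRD ?subrr ?powRr0// (gt_eqF s0) implybT.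
Qed.

Section tail.
Context {R : realType} {n : nat} (n_ge2 : (2 <= n)%N).
Variables (rho h : borel 'rV[R]_n -> R) (alpha : R).
Hypothesis rho_meas : measurable_fun (@Rplus R n) rho.
Hypothesis rho_ge0 : forall x, @Rplus R n x -> 0 <= rho x.
Hypothesis rho_le1 : (\int[lebesgue_rV R n]_(x in @Rplus R n) (rho x)%:E <= 1)%E.
Hypothesis rho_hom : asymptotically_homogeneous rho alpha h.
Implicit Types (x : 'rV[R]_n) (A B U : set (borel 'rV[R]_n)).

Local Notation Rplus := (@Rplus R n).
Local Notation shell := (@shell R n).
Local Notation cap := (@cap R n).
Local Notation lambda := (lebesgue_rV R n).
Local Notation half := (2^-1 : R).

Let n_gt0 : (0 < n)%N. Proof. exact: ltnW. Qed.

Let mR : measurable Rplus. Proof. exact: measurable_Rplus. Qed.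

Let measurable_patch (g : borel 'rV[R]_n -> R) :
  measurable_fun Rplus g -> measurable_fun setT (g \_ Rplus).
Proof. by move=> mg; apply/(measurable_restrict _ _ _).1; rewrite ?setTI. Qed.

Let patch_ge0 (g : borel 'rV[R]_n -> R) :
  (forall x, Rplus x -> 0 <= g x) -> forall x, 0 <= (g \_ Rplus) x.
Proof. by move=> g0 x; rewrite patchE; case: ifPn => // /set_mem/g0. Qed.

Let patch_in (g : borel 'rV[R]_n -> R) x : Rplus x -> (g \_ Rplus) x = g x.
Proof. by move=> Rx; rewrite patchE mem_set. Qed.

Let h_meas : measurable_fun Rplus h. Proof. by case: rho_hom. Qed.

Let h_ge0 x : Rplus x -> 0 <= h x. Proof. by case: rho_hom => _ + _ _ _; apply. Qed.

Let pow_sum x : R := coord_sum x `^ alpha.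

Let pow_meas : measurable_fun Rplus (pow_sum : borel 'rV[R]_n -> R).
Proof.
apply: measurable_funTS; apply: (measurableT_comp (measurable_powR alpha)).
exact: measurable_coord_sum.
Qed.

Let nu := density_measure lambda (measurable_patch rho_meas) (patch_ge0 rho_ge0).
Let Lam := density_measure lambda (measurable_patch h_meas) (patch_ge0 h_ge0).
Let pow_ge0 x (_ : Rplus x) : 0 <= pow_sum x. Proof. exact: powR_ge0. Qed.
Let M := density_measure lambda (measurable_patch pow_meas) (patch_ge0 pow_ge0).

Let b : R := n%:R + alpha.

(** Both sides are limits of the same function of k, along k and along k s. *)
Let h_scale s x : 0 < s -> Rplus x -> h (s *: x) = s `^ alpha * h x.
Proof.
move=> s0 Rx; have [_ _ _ hlim _] := rho_hom.
have Rsx : Rplus (s *: x) by apply/Rplus_scale.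
pose u (k : nat) : R := k.+1%:R^-1.
have u0 k : 0 < u k by rewrite invr_gt0.
have cu : u k @[k --> \oo] --> 0 by exact: cvg_harmonic.
have c1 := (cvg_at_rightP _ _ _).1 (hlim _ Rsx) u (conj u0 cu).
have us0 k : 0 < u k * s by rewrite mulr_gt0.
have cus : u k * s @[k --> \oo] --> 0.
  by rewrite -[X in _ --> X](mul0r s); apply: cvgMl.
have c2 := (cvg_at_rightP _ _ _).1 (hlim _ Rx) _ (conj us0 cus).
have c3 : s `^ alpha * ((u k * s) `^ (- alpha) * rho ((u k * s) *: x)) @[k --> \oo]
    --> s `^ alpha * h x by apply: cvgMr.
apply: cvg_unique c1 _ => //; rewrite (_ : (fun _ => _) =
  (fun k => s `^ alpha * ((u k * s) `^ (- alpha) * rho ((u k * s) *: x)))) //.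
apply/funext => k; rewrite scalerA powRM ?ltW// [RHS]mulrA.
by rewrite [s `^ _ * _]mulrCA powRN_mul// mulr1.
Qed.

Let Lam_hom : homogeneous_measure b Lam.
Proof.
apply: density_homogeneous => s x s0; rewrite !patchE.
have [Rx|nRx] := pselect (Rplus x).
  by rewrite !mem_set ?h_scale//; apply/Rplus_scale.
by rewrite !memNset ?mulr0//; move/(Rplus_scale _ s0).
Qed.

Let M_hom : homogeneous_measure b M.
Proof.
apply: density_homogeneous => s x s0; rewrite !patchE.
have [Rx|nRx] := pselect (Rplus x).
  rewrite !mem_set//; last exact/Rplus_scale.
  by rewrite /pow_sum coord_sum_scale powRM ?(ltW s0)// coord_sum_ge0.
by rewrite !memNset ?mulr0//; move/(Rplus_scale _ s0).
Qed.

(** By homogeneity, uniform convergence on the simplex compares rho and h near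
the origin in every direction. *)
Let rho_near (e : R) : 0 < e -> exists2 r : R, 0 < r & forall x, Rplus x ->
  coord_sum x < r -> `|h x - rho x| <= e * pow_sum x.
Proof.
move=> e0; have [_ _ _ _ /(_ [set g | forall x, open_simplex x ->
    `|h x - g x| < e])] := rho_hom.
move=> /(_ _)/wrap[|].
  apply/uniform_nbhs; exists [set xy : R * R | ball xy.1 e xy.2]; split.
    by rewrite -entourage_ballE; exists e.
  by move=> g /= H x /H; rewrite -ball_normE.
move=> /= [r r0 rP]; exists r => // x Rx xr.
have N0 := coord_sum_gt0 n_gt0 Rx; set k := coord_sum x in N0 xr *.
pose y : 'rV[R]_n := k^-1 *: x.
have xE : x = k *: y by rewrite /y scalerA divff ?scale1r// gt_eqF.
have Ry : Rplus y by apply/Rplus_scale; rewrite ?invr_gt0.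
have yo : open_simplex y.
  apply: (pos_sum1_simplex n_ge2) => //.
  by rewrite -/(coord_sum y) coord_sum_scale mulVf// gt_eqF.
have /(_ _ yo) : [set g | forall x, open_simplex x -> `|h x - g x| < e]
    (fun x => k `^ (- alpha) * rho (k *: x)).
  apply: rP => //=; by rewrite sub0r normrN gtr0_norm.
move=> H; rewrite {1}xE h_scale// {1}xE.
have -> : rho (k *: y) = k `^ alpha * (k `^ (- alpha) * rho (k *: y)).
  by rewrite mulrA powRN_mul// mul1r.
rewrite -mulrBr normrM ger0_norm ?powR_ge0// mulrC /pow_sum -/k.
by rewrite ler_wpM2r ?powR_ge0// ltW.
Qed.

Let nu_le1 A : measurable A -> (nu A <= 1)%E.
Proof.
move=> mA; apply: le_trans rho_le1; rewrite integral_mkcond restrict_EFin.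
by apply: (le_measure nu); rewrite ?inE.
Qed.

Let density_le (g1 g2 : borel 'rV[R]_n -> R) (e : R)
    (m1 : measurable_fun Rplus g1) (m2 : measurable_fun Rplus g2)
    (p1 : forall x, Rplus x -> 0 <= g1 x) (p2 : forall x, Rplus x -> 0 <= g2 x)
    B : measurable B -> 0 <= e ->
  (forall x, B x -> Rplus x -> g1 x <= g2 x + e * pow_sum x) ->
  (density_measure lambda (measurable_patch m1) (patch_ge0 p1) B <=
   density_measure lambda (measurable_patch m2) (patch_ge0 p2) B + e%:E * M B)%E.
Proof.
move=> mB e0 H; rewrite /M /density_measure.
have mE (g : borel 'rV[R]_n -> R) : measurable_fun Rplus g ->
    measurable_fun B (EFin \o (g \_ Rplus)).
  by move=> mg; apply: measurable_funTS; apply/measurable_EFinP; exact: measurable_patch.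
have pE (g : borel 'rV[R]_n -> R) : (forall x, Rplus x -> 0 <= g x) ->
    forall x, B x -> (0 <= ((g \_ Rplus) x)%:E)%E.
  by move=> g0 x _; rewrite lee_fin; exact: patch_ge0.
rewrite -ge0_integralZl ?lee_fin//; [|exact: mE|exact: pE].
rewrite -ge0_integralD//; [|exact: pE|exact: mE| |]; last 2 first.
- by move=> x Bx; apply: mule_ge0; rewrite lee_fin//; exact: patch_ge0.
- by apply: measurable_funeM; exact: mE.
apply: ge0_le_integral => //.
- exact: pE.
- exact: mE.
- by apply: emeasurable_funD; [exact: mE|apply: measurable_funeM; exact: mE].
- move=> x Bx; have [Rx|nRx] := pselect (Rplus x).
    by rewrite !patch_in// -EFinM -EFinD lee_fin; exact: H.
  by rewrite !patchE !memNset// mule0 adde0.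
Qed.

Let compare (e : R) : 0 < e -> exists2 r : R, 0 < r & forall B, measurable B ->
  (forall x, B x -> coord_sum x < r) ->
  (Lam B <= nu B + e%:E * M B)%E /\ (nu B <= Lam B + e%:E * M B)%E.
Proof.
move=> e0; have [r r0 rP] := rho_near e0; exists r => // B mB Br; split.
  apply: density_le => //; first exact: ltW.
  move=> x Bx Rx; have := rP x Rx (Br x Bx).
  by rewrite ler_norml => /andP[_]; lra.
apply: density_le => //; first exact: ltW.
move=> x Bx Rx; have := rP x Rx (Br x Bx).
by rewrite ler_norml => /andP[+ _]; lra.
Qed.

(** The caps decrease to the empty set, as the coordinate sum is positive on the
orthant. *)
Let nu_cap_small (e : R) : 0 < e -> exists2 r : R, 0 < r & (nu (cap r) < e%:E)%E.
Proof.
move=> e0; pose F k := cap k.+1%:R^-1.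
have mF k : measurable (F k) by exact: measurable_cap.
have ndF : nonincreasing_seq F.
  move=> i j ij; apply/subsetPset => x [Rx xj]; split=> //.
  by apply: le_trans xj _; rewrite lef_pV2 ?posrE// ler_nat.
have F0 : \bigcap_k F k = set0.
  apply/seteqP; split=> // x Fx.
  have N0 : 0 < coord_sum x by apply: (coord_sum_gt0 n_gt0); have [] := Fx 0%N Logic.I.
  have [_] := Fx (Num.trunc (coord_sum x)^-1) Logic.I.
  rewrite leNgt => /negP; apply.
  by rewrite invf_plt ?posrE//; exact: truncnS_gt.
have : nu (F k) @[k --> \oo] --> 0%E.
  rewrite -(measure0 nu) -F0; apply: nonincreasing_cvg_mu => //.
    by apply: le_lt_trans (nu_le1 (mF 0%N)) _; exact: ltry.
  by rewrite F0.
move=> /fine_cvgP[_ /cvgr_lt/(_ _ e0)[k _ kP]].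
exists k.+1%:R^-1; rewrite ?invr_gt0//.
have := kP k (leqnn _); rewrite -lte_fin /= fineK//.
rewrite ge0_fin_numE//; apply: le_lt_trans (nu_le1 (mF k)) _; exact: ltry.
Qed.

Let mshell r s : measurable (shell r s). Proof. exact: measurable_shell. Qed.

(** On the shell the power of the coordinate sum is bounded, and the shell lies in
the unit cube. *)
Let M_shell_lty : (M (shell half 1) < +oo)%E.
Proof.
have half0 : 0 < half by rewrite invr_gt0.
pose c := 1 + half `^ alpha.
have c0 : 0 <= c by rewrite addr_ge0// powR_ge0.
have le_c x : shell half 1 x -> pow_sum x <= c.
  move=> [Rx /andP[lo hi]]; rewrite /pow_sum.
  have N0 : 0 < coord_sum x by exact: lt_trans lo.
  have [a0|/ltW a0] := leP 0 alpha.
    apply: (@le_trans _ _ 1); last by rewrite lerDl powR_ge0.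
    have := ge0_ler_powR a0 _ _ hi; rewrite powR1; apply; rewrite nnegrE// ltW//.
  apply: (@le_trans _ _ (half `^ alpha)); last by rewrite lerDr.
  rewrite -(opprK alpha) !(powRN _ (- alpha)) lef_pV2 ?posrE ?powR_gt0//.
  by apply: ge0_ler_powR; rewrite ?oppr_ge0// ?nnegrE ltW.
apply: (@le_lt_trans _ _ (c%:E * lambda (shell half 1))%E).
  rewrite /M /density_measure -integral_cst//; apply: ge0_le_integral => //.
  - by move=> x _; rewrite lee_fin; exact: patch_ge0.
  - by apply: measurable_funTS; apply/measurable_EFinP; exact: measurable_patch.
  - by move=> x sx; rewrite lee_fin patch_in ?le_c//; case: sx.
rewrite lte_mul_pinfty// ?lee_fin//; apply: le_lt_trans (lebesgue_unit_cube_lty R n).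
apply: le_measure; rewrite ?inE//; first exact: measurable_unit_cube.
move=> x [Rx /andP[_ hi]] i; rewrite /= (ltW (Rx i))/=.
apply: le_trans hi; rewrite /coord_sum (bigD1 i)//= lerDl sumr_ge0// => j _.
exact/ltW/Rx.
Qed.

Let shell_hom (mu : {measure set (borel 'rV[R]_n) -> \bar R}) s :
  homogeneous_measure b mu -> 0 < s ->
  mu (shell (half * s) s) = ((s `^ b)%:E * mu (shell half 1))%E.
Proof.
move=> hom s0; rewrite (hom s _ s0)// shell_scale// mulfK ?divff// gt_eqF//.
Qed.

Let Lam_shell s : 0 < s ->
  Lam (shell (half * s) s) = ((s `^ b)%:E * Lam (shell half 1))%E.
Proof. exact: shell_hom Lam_hom. Qed.

Let M_shell s : 0 < s ->
  M (shell (half * s) s) = ((s `^ b)%:E * M (shell half 1))%E.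
Proof. exact: shell_hom M_hom. Qed.

Let shell_lt r s x : shell (half * s) s x -> s < r -> coord_sum x < r.
Proof. by move=> [_ /andP[_ xs]]; exact: le_lt_trans. Qed.

(** Near the origin Lam is at most nu + M, and a shell there is a multiple of the
given one. *)
Let Lam_shell_lty : (Lam (shell half 1) < +oo)%E.
Proof.
have [r r0 rP] := compare ltr01.
have s0 : 0 < r / 2 by rewrite divr_gt0.
have sr : r / 2 < r by rewrite ltr_pdivrMr// ltr_pMr// ltr1n.
have [+ _] := rP (shell (half * (r / 2)) (r / 2)) (mshell _ _)
  (fun x sx => shell_lt sx sr).
rewrite mul1e (Lam_shell s0) (M_shell s0) => le1.
rewrite -(@lte_pmul2l _ ((r / 2) `^ b)%:E) ?lte_fin ?powR_gt0//.
rewrite gt0_muley ?lte_fin ?powR_gt0//; apply: le_lt_trans le1 _.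
rewrite lte_add_pinfty//; first by apply: le_lt_trans (nu_le1 (mshell _ _)) _; exact: ltry.
by rewrite lte_mul_pinfty// lee_fin powR_ge0.
Qed.

Let Lam_shell_gt0 : (0 < Lam (shell half 1))%E.
Proof.
rewrite lt0e measure_ge0 andbT; apply/eqP => L0.
have [_ _ + _ _] := rho_hom.
have := Rplus_null n_gt0 Lam_hom L0.
rewrite [LHS](_ : _ = (\int[lambda]_(x in Rplus) (h x)%:E)%E); last first.
  by apply: eq_integral => x /set_mem Rx /=; rewrite patch_in.
by move=> ->; rewrite ltxx.
Qed.

(** If n + alpha <= 0, the masses of the shells shrinking to the origin would stay
bounded below for h, hence for rho, against the integrability of rho. *)
Lemma exponent_gt0 : 0 < n%:R + alpha.
Proof.
rewrite -/b ltNge; apply/negP => b0.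
pose l := fine (Lam (shell half 1)); pose m := fine (M (shell half 1)).
have lE : Lam (shell half 1) = l%:E by rewrite fineK// ge0_fin_numE.
have mE : M (shell half 1) = m%:E by rewrite fineK// ge0_fin_numE.
have l0 : 0 < l by rewrite -lte_fin -lE.
have m0 : 0 <= m by exact: fine_ge0.
pose e := l / (2 * (m + 1)).
have m1 : 0 < 2 * (m + 1) by lra.
have e0 : 0 < e by rewrite divr_gt0.
have em : e * m <= l / 2.
  have : e * (2 * (m + 1)) = l by rewrite /e divfK// gt_eqF.
  nra.
have [r r0 rP] := compare e0.
have l2 : 0 < l / 2 by rewrite divr_gt0.
have [r' r'0 r'P] := nu_cap_small l2.
pose s := Num.min (r / 2) (Num.min r' 1).
have s0 : 0 < s by rewrite !lt_min divr_gt0//= r'0 ltr01.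
have sr : s < r by rewrite gt_min ltr_pdivrMr// ltr_pMr// ltr1n.
have sr' : s <= r' by rewrite !ge_min lexx !orbT.
have s1 : s <= 1 by rewrite !ge_min lexx !orbT.
have [+ _] := rP (shell (half * s) s) (mshell _ _) (fun x sx => shell_lt sx sr).
rewrite (Lam_shell s0) (M_shell s0) lE mE.
have : (nu (shell (half * s) s) < (l / 2)%:E)%E.
  apply: le_lt_trans r'P; apply: le_measure; rewrite ?inE//.
    exact: measurable_cap.
  by move=> x [Rx /andP[_ xs]]; split=> //; exact: le_trans sr'.
move=> lt1 le1; have := le_lt_trans le1 (lte_leD _ lt1 (lexx _)).
rewrite -!EFinM -EFinD => /(_ isT); rewrite lte_fin.
have sb : 1 <= s `^ b.
  rewrite -(opprK b) powRN invf_ge1 ?powR_gt0//.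
  have := @ge0_ler_powR R (- b) _ s 1; rewrite oppr_ge0 powR1; apply=> //.
  by rewrite nnegrE ltW.
  by rewrite nnegrE.
have : s `^ b * (e * m) <= s `^ b * (l / 2) by rewrite ler_pM2l ?powR_gt0.
have : l / 2 <= s `^ b * (l / 2) by rewrite ler_peMl// ltW.
nra.
Qed.

Let Lam_cap_lty : (Lam (cap 1) < +oo)%E.
Proof. exact: (cap_lty n_gt0 Lam_hom exponent_gt0). Qed.

Let M_cap_lty : (M (cap 1) < +oo)%E.
Proof. exact: (cap_lty n_gt0 M_hom exponent_gt0). Qed.

Let Lam_capE r : 0 < r -> Lam (cap r) = ((r `^ b)%:E * Lam (cap 1))%E.
Proof. exact: (mu_cap Lam_hom). Qed.

Let M_capE r : 0 < r -> M (cap r) = ((r `^ b)%:E * M (cap 1))%E.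
Proof. exact: (mu_cap M_hom). Qed.

(** The intensity measure of the limiting Poisson process. *)
Definition tail_mass U : R := fine (Lam U).

Lemma tail_mass_cap r : 0 < r -> tail_mass (cap r) = r `^ b * tail_mass (cap 1).
Proof.
by move=> r0; rewrite /tail_mass Lam_capE// fineM// ge0_fin_numE.
Qed.

Lemma tail_mass_cap_gt0 : 0 < tail_mass (cap 1).
Proof.
rewrite fine_gt0// Lam_cap_lty andbT; apply: lt_le_trans Lam_shell_gt0 _.
apply: le_measure; rewrite ?inE//; first exact: measurable_cap.
by move=> x [Rx /andP[_]].
Qed.

(** With a ^ b = K, the set U shrunk by the factor a has Lam-mass Lam U / K;
near the origin rho may be replaced by h. *)
Lemma tail_limit U (r : R) : measurable U -> U `<=` cap r ->
  K%:R * fine (\int[lambda]_(x in scale (K%:R `^ b^-1) @^-1` U `&` Rplus)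
    (rho x)%:E)%E @[K --> \oo] --> tail_mass U.
Proof.
move=> mU Ur'; pose r1 := Num.max r 1.
have r10 : 0 < r1 by rewrite lt_max ltr01 orbT.
have Ur : U `<=` cap r1.
  by move=> x /Ur'[Rx xr]; split=> //; rewrite (le_trans xr)// le_max lexx.
have b0 : 0 < b := exponent_gt0.
have LU : (Lam U < +oo)%E.
  apply: (@le_lt_trans _ _ (Lam (cap r1))).
    by apply: le_measure; rewrite ?inE//; exact: measurable_cap.
  by rewrite Lam_capE// lte_mul_pinfty// lee_fin powR_ge0.
have MU : (M U < +oo)%E.
  apply: (@le_lt_trans _ _ (M (cap r1))).
    by apply: le_measure; rewrite ?inE//; exact: measurable_cap.
  by rewrite M_capE// lte_mul_pinfty// lee_fin powR_ge0.
pose l := fine (Lam U); pose m := fine (M U).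
have lE : Lam U = l%:E by rewrite fineK// ge0_fin_numE.
have mE : M U = m%:E by rewrite fineK// ge0_fin_numE.
have m0 : 0 <= m by exact: fine_ge0.
apply/cvgrPdist_le => e e0.
pose c := e / (m + 1).
have m1 : 0 < m + 1 by rewrite ltr_wpDl.
have c0 : 0 < c by rewrite divr_gt0.
have cm : c * m <= e.
  have : c * (m + 1) = e by rewrite /c divfK// gt_eqF.
  by move=> <-; rewrite ler_pM2l// lerDl.
have [k k0 kP] := compare c0.
near=> K.
have K0 : 0 < K%:R :> R by rewrite ltr0n; near: K; exact: nbhs_infty_gt.
pose a : R := K%:R `^ b^-1.
have a0 : 0 < a by exact: powR_gt0.
have aK : a `^ b = K%:R by rewrite /a -powRrM mulVf ?gt_eqF// powRr1// ltW.
have ak : r1 / k < a.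
  have rk0 : 0 < r1 / k by rewrite divr_gt0.
  rewrite -[ltLHS](powRr1 (ltW rk0)) -(mulfV (lt0r_neq0 b0)) powRrM /a.
  apply: gt0_ltr_powR; rewrite ?invr_gt0 ?nnegrE ?powR_ge0 ?ler0n//.
  by near: K; exact: nbhs_infty_gtr.
pose B := scale a @^-1` U.
have mB : measurable B by exact: measurable_preimage_scale.
have Bk x : B x -> coord_sum x < k.
  move=> /Ur[_]; rewrite /scale coord_sum_scale => xr.
  rewrite -(ltr_pM2l a0); apply: le_lt_trans xr _.
  by rewrite -ltr_pdivrMr.
have [le1 le2] := kP B mB Bk.
have nuE : (\int[lambda]_(x in B `&` Rplus) (rho x)%:E)%E = nu B.
  by rewrite integral_mkcondr restrict_EFin.
rewrite -/a -/B nuE.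
have nu_fin : nu B \is a fin_num.
  rewrite ge0_fin_numE//; apply: le_lt_trans (nu_le1 mB) _; exact: ltry.
have KV (z : \bar R) : z = ((K%:R^-1)%:E * (K%:R%:E * z))%E.
  by rewrite muleA -EFinM mulVf ?mul1e// gt_eqF.
have LB : Lam B = (K%:R^-1 * l)%:E.
  rewrite [LHS]KV EFinM; congr (_ * _)%E.
  by rewrite -lE -aK; exact: esym (Lam_hom a0 mU).
have MB : M B = (K%:R^-1 * m)%:E.
  rewrite [LHS]KV EFinM; congr (_ * _)%E.
  by rewrite -mE -aK; exact: esym (M_hom a0 mU).
rewrite LB MB -(fineK nu_fin) -!EFinM -!EFinD !lee_fin in le1 le2.
rewrite -(ler_pM2l K0) mulrDr (mulrCA _ c) !(mulVKf (lt0r_neq0 K0)) in le1.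
rewrite -(ler_pM2l K0) mulrDr (mulrCA _ c) !(mulVKf (lt0r_neq0 K0)) in le2.
rewrite /tail_mass -/l ler_norml; apply/andP; split; lra.
Unshelve. all: by end_near. Qed.

End tail.

(** * The law of the minimum *)

Section poisson_limit.
Context {R : realType}.

(** The probability that a sample of size K avoids an event of probability q K,
by the bounds exp (- q / (1 - q)) <= 1 - q <= exp (- q). *)
Lemma cvg_exp_pow (q : nat -> R) (l : R) : (forall K, (0 < K)%N -> 0 <= q K <= 1) ->
  K%:R * q K @[K --> \oo] --> l ->
  (1 - q K) ^+ K @[K --> \oo] --> expR (- l).
Proof.
move=> q01 ql.
have q_small e : 0 < e -> \forall K \near \oo, q K < e.
  move=> e0; near=> K.
  have K0 : 0 < K%:R :> R by rewrite ltr0n; near: K; exact: nbhs_infty_gt.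
  rewrite -(ltr_pM2l K0); apply: (@lt_trans _ _ (l + 1)).
    by near: K; apply: (cvgr_lt _ ql); rewrite ltrDl.
  by rewrite -ltr_pdivrMr//; near: K; exact: nbhs_infty_gtr.
have q0 : q K @[K --> \oo] --> 0.
  apply/cvgrPdist_lt => e e0; near=> K.
  have K0 : (0 < K)%N by near: K; exact: nbhs_infty_gt.
  rewrite sub0r normrN ger0_norm; last by have /andP[] := q01 K K0.
  by near: K; exact: q_small.
have up : expR (- (K%:R * q K)) @[K --> \oo] --> expR (- l).
  by apply: continuous_cvg; [exact: continuous_expR|exact: cvgN].
have lo : expR (- (K%:R * q K / (1 - q K))) @[K --> \oo] --> expR (- l).
  apply: continuous_cvg; first exact: continuous_expR.
  apply: cvgN; rewrite -[X in _ --> X]divr1; apply: cvgM => //.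
  apply: cvgV; first exact: oner_neq0.
  by rewrite -[X in _ --> X]subr0; apply: cvgB => //; exact: cvg_cst.
apply: squeeze_cvgr lo up; near=> K.
have q1 : q K < 1 by near: K; exact: q_small.
have K0 : (0 < K)%N by near: K; exact: nbhs_infty_gt.
have /andP[qge0 _] := q01 K K0.
have p0 : 0 < 1 - q K by rewrite subr_gt0.
apply/andP; split.
  rewrite -mulrA -mulrN mulrC expRM_natr; apply: lerXn2r; rewrite ?nnegrE ?expR_ge0 ?(ltW p0)//.
  rewrite expRN -[leRHS]invrK lef_pV2 ?posrE ?expR_gt0 ?invr_gt0//.
  apply: le_trans (expR_ge1Dx _); rewrite le_eqVlt; apply/orP; left; apply/eqP.
  by field; rewrite gt_eqF.
rewrite -mulrN mulrC expRM_natr; apply: lerXn2r; rewrite ?nnegrE ?expR_ge0 ?(ltW p0)//.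
exact: expR_ge1Dx.
Unshelve. all: by end_near. Qed.

End poisson_limit.

Section minimum_law.
Context {R : realType} {n : nat} (n_ge2 : (2 <= n)%N).

Local Notation test_point := (@test_point R n n_ge2).
Local Notation test_level := (@test_level R n).

(** A minimum of linear functions passes all tests of J exactly when none of the
coefficient vectors lies in this set. *)
Definition failing (J : seq nat) : set (borel 'rV[R]_n) :=
  [set x | Rplus x /\
     has (fun i => \sum_(k < n) x 0 k * simplex_val (test_point i) 0 k
                   <= test_level i) J].

Lemma measurable_failing J : measurable (failing J).
Proof.
rewrite (_ : failing J = @Rplus R n `&` [set x : borel 'rV[R]_n |
  has (fun i => \sum_(k < n) (x : 'rV[R]_n) 0 k * simplex_val (test_point i) 0 k
                <= test_level i) J])//.
apply: measurableI; first exact: measurable_Rplus.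
elim: J => [|i J IH] /=.
  by rewrite (_ : [set _ | _] = set0)//; apply/seteqP; split.
rewrite (_ : [set _ | _] = [set x : borel 'rV[R]_n |
    \sum_(k < n) x 0 k * simplex_val (test_point i) 0 k <= test_level i] `|`
    [set x | has (fun i => \sum_(k < n) x 0 k * simplex_val (test_point i) 0 k
                   <= test_level i) J]); last first.
  by apply/seteqP; split=> x /=; [move/orP|move=> [->|->]; rewrite ?orbT].
apply: measurableU => //.
rewrite (_ : [set _ | _] = (fun x : borel 'rV[R]_n =>
  \sum_(k < n) x 0 k * simplex_val (test_point i) 0 k) @^-1`
  `]-oo, test_level i]%classic).
  rewrite -[X in measurable X]setTI; apply: measurable_sum => // k.
  by apply: measurable_funM => //; exact: measurable_coord.
by apply/seteqP; split=> x /=; rewrite in_itv.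
Qed.

(** Test points are interior, so a linear form takes large values there when its
coefficients are large. *)
Lemma failing_bounded J : exists r, failing J `<=` cap r.
Proof.
elim: J => [|i J [r rJ]]; first by exists 0 => x [_].
have cA : @inner_compact R n [set test_point i].
  by split; [exact: compact_set1|move=> _ ->; exact: grid_open].
have [a a0 /(_ _ erefl) pa] := inner_compact_coord_ge cA.
exists (Num.max r (test_level i / a)) => x [Rx /= /orP[xi|xJ]]; last first.
  have [_ xr] := rJ x (conj Rx xJ).
  by split=> //; rewrite le_max xr.
split=> //; rewrite le_max; apply/orP; right; rewrite ler_pdivlMr//.
apply: le_trans xi; rewrite /coord_sum mulr_suml; apply: ler_sum => k _.
by rewrite ler_wpM2l//; exact/ltW/Rx.
Qed.

Lemma scaled_min_gt (a t : R) K (c : nat -> orthant R n) (p : simplex R n) :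
  0 < a -> (0 < K)%N ->
  (t < scaled_min a K c p) <-> forall k, (k < K)%N -> t < a * ell (c k) p.
Proof.
move=> a0 K0; rewrite /scaled_min -ltr_pdivrMl//.
split=> [/bigmin_gtP[_ H] k kK|H].
  by rewrite -ltr_pdivrMl//; exact: (H (Ordinal kK)).
apply/bigmin_gtP; split; first by rewrite ltr_pdivrMl// H.
by move=> k _; rewrite ltr_pdivrMl// H.
Qed.

Lemma ell_scale (a : R) (c : orthant R n) (p : simplex R n) :
  \sum_(k < n) (scale a (orthant_val c) : 'rV[R]_n) 0 k * simplex_val p 0 k =
  a * ell c p.
Proof.
by rewrite /ell mulr_sumr; apply: eq_bigr => k _; rewrite /scale mxE mulrA.
Qed.

Lemma failingE (a : R) (c : orthant R n) J : 0 < a ->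
  failing J (scale a (orthant_val c)) <->
  has (fun i => a * ell c (test_point i) <= test_level i) J.
Proof.
move=> a0; have Ra : Rplus (scale a (orthant_val c)).
  by apply/Rplus_scale => // i; exact: orthant_coord_gt0.
under [X in _ <-> is_true X]eq_has do rewrite -ell_scale.
by split=> [[]|].
Qed.

Lemma measurable_orthant_val :
  measurable_fun setT (fun c : borel (orthant R n) => orthant_val c : borel 'rV[R]_n).
Proof. by apply: measurable_rV => i; exact: measurable_orthant_coord. Qed.

Context d0 (T0 : measurableType d0) (P0 : probability T0 R).
Variables (C : {RV P0 >-> borel (orthant R n)}) (rho : borel 'rV[R]_n -> R).
Hypothesis C_density : joint_density C rho.
Context d (T : measurableType d) (P : probability T R).
Variable Cs : nat -> {RV P >-> borel (orthant R n)}.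
Hypothesis Cs_copies : independent_copies Cs C.
Variable alpha : R.

Let q (J : seq nat) (K : nat) : R :=
  fine (\int[lebesgue_rV R n]_(x in
    scale (K%:R `^ (n%:R + alpha)^-1) @^-1` failing J `&` @Rplus R n) (rho x)%:E)%E.

(** The K rescaled coefficient vectors are independent, and each one lies outside
[failing J] with probability 1 - q J K. *)
Lemma prob_passes J (K : nat) : (0 < K)%N -> 0 <= q J K <= 1 /\
  prob (distribution P (Psi alpha Cs K)) [set psi | all (passes n_ge2 psi) J] =
  (1 - q J K) ^+ K.
Proof.
move=> K0; pose a : R := K%:R `^ (n%:R + alpha)^-1.
have a0 : 0 < a by apply: powR_gt0; rewrite ltr0n.
pose F : set (borel (orthant R n)) :=
  [set c | failing J (scale a (orthant_val c))].
have mB : measurable (scale a @^-1` failing J).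
  by apply: measurable_preimage_scale; exact: measurable_failing.
have mF : measurable F.
  by rewrite -[X in measurable X]setTI; exact: (measurable_orthant_val measurableT mB).
have mFC : measurable [set w | F (C w)].
  have mC : measurable_fun setT C by exact: measurable_funPT.
  by rewrite -[X in measurable X]setTI; exact: (mC measurableT F mF).
have qE : P0 [set w | F (C w)] = (q J K)%:E.
  have [_ _ /(_ _ mB) H] := C_density.
  by rewrite /q -H fineK//; exact: fin_num_measure mFC.
split.
  have qp : q J K = prob P0 [set w | F (C w)] by rewrite /prob qE.
  by rewrite qp prob_ge0 prob_le1.
have PF k : P (Cs k @^-1` ~` F) = (1 - q J K)%:E.
  have [_ /(_ k (~` F) (measurableC mF))] := Cs_copies.
  rewrite /distribution /pushforward => ->.
  by rewrite preimage_setC probability_setC// [P0 _]qE.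
have [indep _] := Cs_copies.
pose I : {fset nat} := [fset k | k in iota 0 K]%fset.
have IE k : (k \in I) = (k < K)%N.
  by rewrite /I !inE /= mem_iota.
have cI : size I = K by rewrite -/(#|` I|) card_fseq undup_id ?iota_uniq ?size_iota.
have := indep I (fun=> ~` F) (fun=> measurableC mF).
rewrite (eq_bigr (fun=> (1 - q J K)%:E)) => [|k _]; last exact: PF.
have prodE (s : seq nat) (x : R) : (\prod_(i <- s) x%:E)%E = (x ^+ size s)%:E.
  elim: s => [|k s IH]; first by rewrite big_nil.
  by rewrite big_cons IH /= exprS EFinM.
rewrite prodE cI => PI.
suff bigE : Psi alpha Cs K @^-1` [set psi | all (passes n_ge2 psi) J] =
    \bigcap_(k in [set` I]) Cs k @^-1` ~` F.
  transitivity (fine (P (Psi alpha Cs K @^-1` [set psi | all (passes n_ge2 psi) J]))).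
    by [].
  by rewrite bigE PI.
apply/seteqP; split=> w.
  move=> /allP Hw k /=; rewrite IE => kK /(failingE _ _ a0)/hasP[i iJ].
  apply/negP; rewrite -ltNge.
  by have := Hw i iJ; rewrite /passes => /scaled_min_gt; apply.
move=> Hw; apply/allP => i iJ; apply/scaled_min_gt => // k kK.
have : ~ failing J (scale a (orthant_val (Cs k w))) by apply: Hw; rewrite /= IE.
by rewrite failingE// => /negP/hasPn/(_ i iJ); rewrite -ltNge.
Qed.

End minimum_law.

Theorem theorem3p5 (R : realType) (n : nat) (n_ge2 : (2 <= n)%N)
    (d0 : measure_display) (T0 : measurableType d0) (P0 : probability T0 R)
    (C : {RV P0 >-> borel (orthant R n)})
    (rho : borel 'rV[R]_n -> R) (alpha : R) (h : borel 'rV[R]_n -> R)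
    (C_density : joint_density C rho)
    (rho_homogeneous : asymptotically_homogeneous rho alpha h)
    (d : measure_display) (T : measurableType d) (P : probability T R)
    (Cs : nat -> {RV P >-> borel (orthant R n)})
    (Cs_copies : independent_copies Cs C) :
  exists mu : probability (borel (concave_fun R n)) R,
    mu (@concave_pos R n) = 1%E /\
    converges_weakly (fun K : nat => distribution P (Psi alpha Cs K)) mu.
Proof.
have [rho_meas rho_ge0 rho_law] := C_density.
have rho_le1 : (\int[lebesgue_rV R n]_(x in @Rplus R n) (rho x)%:E <= 1)%E.
  have := rho_law setT measurableT; rewrite setTI => <-.
  by rewrite [X in P0 X](_ : _ = setT) ?probability_setT.
pose L := tail_mass rho_homogeneous.
have tests_lim J : prob (distribution P (Psi alpha Cs K))
    [set psi | all (passes n_ge2 psi) J] @[K --> \oo] -->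
    expR (- L (@failing R n n_ge2 J)).
  have [r Jr] := @failing_bounded R n n_ge2 J.
  have lim := cvg_exp_pow
    (fun K K0 => (prob_passes n_ge2 C_density Cs_copies alpha J K0).1)
    (tail_limit (rho_hom := rho_homogeneous) n_ge2 rho_meas rho_ge0 rho_le1
      (@measurable_failing R n n_ge2 J) Jr).
  apply: (cvg_trans _ lim); apply: near_eq_cvg; near=> K.
  have K0 : (0 < K)%N by near: K; exact: nbhs_infty_gt.
  by have [_ ->] := prob_passes n_ge2 C_density Cs_copies alpha J K0.
have b0 : 0 < n%:R + alpha.
  exact: (exponent_gt0 n_ge2 rho_meas rho_ge0 rho_le1 rho_homogeneous).
have L1 : 0 < L (cap 1).
  exact: (tail_mass_cap_gt0 n_ge2 rho_meas rho_ge0 rho_le1 rho_homogeneous).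
have L_cap r : 0 < r -> L (cap r) = r `^ (n%:R + alpha) * L (cap 1).
  exact: (tail_mass_cap n_ge2 rho_meas rho_ge0 rho_le1 rho_homogeneous).
have n0 : 0 < n%:R :> R by rewrite ltr0n ltnW.
(* As r varies, the mass of the cap of size r takes every positive value y. *)
have radius (y : R) : 0 < y -> exists2 r : R, 0 < r &
    r `^ (n%:R + alpha) * L (cap 1) = y.
  move=> y0; exists ((y / L (cap 1)) `^ (n%:R + alpha)^-1).
    by rewrite powR_gt0// divr_gt0.
  rewrite -powRrM mulVf ?gt_eqF// powRr1 ?divfK ?gt_eqF//.
  by rewrite divr_ge0// ltW.
(* The form x takes at the barycenter the value coord_sum x / n, so a single test
   there fails exactly on a cap. *)
have barycenter_test (x : rat) : exists i,
    [/\ test_point n_ge2 i = barycenter n_ge2 :> simplex R n,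
      @test_level R n i = ratr x & @failing R n n_ge2 [:: i] = cap (n%:R * ratr x)].
  have [i [ip il]] := @test_surj R n n_ge2 (fun=> 0%N) x.
  have ic : test_point n_ge2 i = barycenter n_ge2 :> simplex R n by rewrite ip grid0.
  exists i; split=> //.
  have sumE (z : 'rV[R]_n) : \sum_(k < n) z 0 k *
      simplex_val (test_point n_ge2 i) 0 k = coord_sum z / n%:R.
    by rewrite ic mulr_suml; apply: eq_bigr => k _; rewrite barycenterE.
  have levelE (z : 'rV[R]_n) : (coord_sum z <= n%:R * ratr x) =
      (\sum_(k < n) z 0 k * simplex_val (test_point n_ge2 i) 0 k <= @test_level R n i).
    by rewrite sumE il ler_pdivrMr// mulrC.
  apply/seteqP; split=> z [Rz]; rewrite ?has_seq1 => H; split=> //.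
    by have := levelE z; rewrite H => e; exact: e.
  by rewrite has_seq1; have := levelE z; rewrite [LHS]H => /esym e; exact: e.
apply: (@limit_law_exists R n n_ge2 (fun K => distribution P (Psi alpha Cs K))) => [J|e e0|e e0].
- by apply/cvg_ex; exists (expR (- L (@failing R n n_ge2 J))).
(* A level of mass at least 1 / e is passed with limiting probability at most
   exp (- 1 / e) < e. *)
- have eV : 0 < e^-1 by rewrite invr_gt0.
  have [r r0 rE] := radius _ eV.
  have lt : r / n%:R < r / n%:R + 1 by rewrite ltrDl.
  have [x] := rat_in_itvoo lt.
  rewrite in_itv/= => /andP[rx _]; have [i [ic il iF]] := barycenter_test x.
  exists i; split=> //.
  have nx : r < n%:R * ratr x by rewrite mulrC -ltr_pdivrMr.
  have := tests_lim [:: i]; rewrite iF => lim.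
  have lim_lt : expR (- L (cap (n%:R * ratr x))) < e.
    rewrite L_cap ?(lt_trans r0)// expRN invf_plt ?posrE ?expR_gt0//.
    have : e^-1 <= (n%:R * ratr x) `^ (n%:R + alpha) * L (cap 1).
      rewrite -rE ler_pM2r//; apply: ge0_ler_powR; rewrite ?nnegrE ltW//.
      exact: lt_trans nx.
    move=> /le_lt_trans; apply; apply: lt_le_trans (expR_ge1Dx _).
    by rewrite ltrDr.
  near=> K.
  have : prob (distribution P (Psi alpha Cs K))
      [set psi | all (passes n_ge2 psi) [:: i]] < e.
    by near: K; exact: (cvgr_lt _ lim _ lim_lt).
  by move=> /ltW; congr (_ <= _); congr prob; apply/seteqP; split=> psi /=;
    rewrite andbT.
(* A level of mass at most e / 2 is passed with limiting probability at least
   exp (- e / 2) >= 1 - e / 2. *)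
- have e2 : 0 < e / 2 by rewrite divr_gt0.
  have [r r0 rE] := radius _ e2.
  have rn0 : 0 < r / n%:R by rewrite divr_gt0.
  have [x] := rat_in_itvoo rn0.
  rewrite in_itv/= => /andP[x0 xr]; have [i [ic il iF]] := barycenter_test x.
  exists i; split=> //; first by rewrite il.
  have nx0 : 0 < n%:R * ratr x :> R by rewrite mulr_gt0.
  have nx : n%:R * ratr x < r by rewrite mulrC -ltr_pdivlMr.
  have := tests_lim [:: i]; rewrite iF => lim.
  have lim_gt : 1 - e < expR (- L (cap (n%:R * ratr x))).
    rewrite L_cap//; apply: lt_le_trans (expR_ge1Dx _); rewrite ltrD2l ltrN2.
    apply: (@le_lt_trans _ _ (e / 2)).
      rewrite -rE ler_pM2r//; apply: ge0_ler_powR; rewrite ?nnegrE ltW//.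
    by rewrite ltr_pdivrMr// ltr_pMr// ltr1n.
  near=> K.
  have : 1 - e < prob (distribution P (Psi alpha Cs K))
      [set psi | all (passes n_ge2 psi) [:: i]].
    by near: K; exact: (cvgr_gt _ lim _ lim_gt).
  by move=> /ltW; congr (_ <= _); congr prob; apply/seteqP; split=> psi /=;
    rewrite andbT.
Unshelve. all: by end_near. Qed.
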